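(* Let $\lambda,\mu\in\mathbb{Z}$ and $\alpha,\beta\in\mathbb{Z}$. All modules are right $\mathfrak{sl}_2$-modules. (1) Case $\lambda\ge2$. There are exactly three isomorphism classes of modules $R(\lambda,\alpha)$, given by $\alpha\le-\lambda$, $\alpha\ge0$ and $1-\lambda\le\alpha\le-1$ respectively (that is, $R(\lambda,\alpha)\cong R(\lambda,\beta)$ if and only if $\alpha,\beta$ lie in the same range). Denote them by $R(\lambda,<)$, $R(\lambda,>)$ and $R(\lambda,=)$. There are exact sequences \begin{align*} \text{(a)}\quad&0\to M(-\lambda)^-\to R(\lambda,<)\to M(\lambda-2)^\vee\to0\\ \text{(b)}\quad&0\to M(\lambda-2)^-\to R(\lambda,<)\to M(-\lambda)\to0\\ \text{(c)}\quad&0\to M(-\lambda)\to R(\lambda,>)\to M(\lambda-2)^{-\vee}\to0\\ \text{(d)}\quad&0\to M(\lambda-2)\to R(\lambda,>)\to M(-\lambda)^-\to0\\ \text{(e)}\quad&0\to M(-\lambda)\to R(\lambda,=)\to M(\lambda-2)^-\to0\\ \text{(f)}\quad&0\to M(-\lambda)^-\to R(\lambda,=)\to M(\lambda-2)\to0. \end{align*} (2) Case $\lambda\le0$. There are exactly three isomorphism classes of modules $R(\lambda,\alpha)$, given by $\alpha\le-1$, $\alpha\ge1-\lambda$ and $0\le\alpha\le-\lambda$ respectively. Denote them by $R(\lambda,<)$, $R(\lambda,>)$ and $R(\lambda,=)$. There are exact sequences \begin{align*} &0\to M(\lambda-2)^-\to R(\lambda,<)\to M(-\lambda)^\vee\to0,\qquad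 0\to M(-\lambda)^-\to R(\lambda,<)\to M(\lambda-2)\to0,\\ &0\to M(\lambda-2)\to R(\lambda,>)\to M(-\lambda)^{-\vee}\to0,\qquad 0\to M(-\lambda)\to R(\lambda,>)\to M(\lambda-2)^-\to0,\\ &0\to M(\lambda-2)\to R(\lambda,=)\to M(-\lambda)^-\to0,\qquad 0\to M(\lambda-2)^-\to R(\lambda,=)\to M(-\lambda)\to0. \end{align*} (3) There are exactly two isomorphism classes of modules $R(1,\alpha)$, given by $\alpha\le-1$ and $\alpha\ge0$ respectively. Denote them by $R(1,<)$ and $R(1,>)$. There are exact sequences \begin{align*} \text{(g)}\quad&0\to M(-1)^-\to R(1,<)\to M(-1)\to0\\ \text{(h)}\quad&0\to M(-1)\to R(1,>)\to M(-1)^-\to0. \end{align*} (4) Let $\lambda\ne\mu$. Then $R(\lambda,\alpha)\cong R(\mu,\beta)$ if and only if $\mu=-\lambda+2$ and $\alpha$ and $\beta$ belong to corresponding isomorphism classes in (1) and (2) (i.e. $R(\lambda,\alpha)$ and $R(\mu,\beta)$ are both of type $<$, both of type $>$, or both of type $=$). (5) For every $\lambda$, $R(\lambda,<)^-\cong R(\lambda,<)^\vee\cong R(\lambda,>)$, and for $\lambda\neq1$, $R(\lambda,=)^-\cong R(\lambda,=)$. The functor $(\cdot)^-$ exchanges (a) with (c), (b) with (d), (e) with (f) and (g) with (h). The functor $(\cdot)^\vee$ exchanges (a) with (d), (b) with (c) and (g) with (h).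
   Context: Everything is over $\mathbb{C}$; $\mathfrak{sl}_2$ has standard basis $e,f,h$, and $\mathfrak{sl}_2$-modules are right modules. For $\lambda\in\mathbb{Z}$, $\alpha\in\mathbb{C}$, $$R(\lambda,\alpha)=\mathcal{U}\mathfrak{sl}_2/(h+2\alpha+\lambda,\ ef+(\alpha+\lambda)(\alpha+1)),$$ the quotient by the right ideal generated by the two elements; equivalently $R(\lambda,\alpha)=(\mathcal{U}\mathfrak{sl}_2)_{\chi_\lambda}/(h+2\alpha+\lambda)$ with $(\mathcal{U}\mathfrak{sl}_2)_{\chi_\lambda}=\mathcal{U}\mathfrak{sl}_2/(c-\tfrac12\lambda(\lambda-2))$, $c=ef+fe+\tfrac{h^2}2$. For $\mu\in\mathbb{C}$ the (right) Verma module $M(\mu)$ has basis $vf^n$ ($n\ge0$) with $ve=0$, $vh=-\mu v$ (it is obtained from the usual left Verma module of highest weight $\mu$ via the anti-involution $e\mapsto e,f\mapsto f,h\mapsto-h$). For a right module $N$, $N^-$ is its twist by the involution $h\mapsto-h$, $e\mapsto f$, $f\mapsto e$ of $\mathfrak{sl}_2$. For a weight module $N=\bigoplus_\nu N_\nu$ (with $N_\nu=\{v: vh=\nu v\}$) with finite-dimensional weight spaces, $N^\vee=\bigoplus_\nu\mathrm{Hom}_{\mathbb{C}}(N_\nu,\mathbb{C})$ with $(\phi X)(v)=\phi(v\tau(X))$, where $\tau$ is the anti-involution $h\mapsto h$, $e\mapsto f$, $f\mapsto e$; $(\cdot)^\vee$ is exact contravariant, $(\cdot)^-$ is exact covariant,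 they commute, and $N^{-\vee}=(N^-)^\vee$. ''Exchanges'' two exact sequences means that applying the functor to either one yields the other, up to isomorphism. *)

(* Defs.v *)
From HB Require Import structures.
From mathcomp Require Import all_boot all_order all_algebra.
From mathcomp Require Import ring_quotient generic_quotient.
From mathcomp Require Import boolp functions reals.
From mathcomp Require Import complex monalg ring.

Set Implicit Arguments.
Unset Strict Implicit.
Unset Printing Implicit Defensive.

Import Order.TTheory GRing.Theory Num.Theory.

Local Open Scope ring_scope.
Local Open Scope quotient_scope.

(* The standard basis of sl_2: [E,F] = H, [H,E] = 2E, [H,F] = -2F. *)
Variant sl2 : Set := E | F | H.

Definition sl2_code (x : sl2) : nat := match x with E => 0 | F => 1 | H => 2 end.
Definition sl2_decode (n : nat) : option sl2 :=
  match n with 0 => Some E | 1 => Some F | 2 => Some H | _ => None end.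
Lemma sl2_codeK : pcancel sl2_code sl2_decode. Proof. by case. Qed.

HB.instance Definition _ := Equality.copy sl2 (pcan_type sl2_codeK).
HB.instance Definition _ := Choice.copy sl2 (pcan_type sl2_codeK).

Section RightModules.
Variable K : fieldType.

(* Right modules over sl_2: [act x v], also written v \act x, is the vector v.x,
   and the axioms say v.[x,y] = (v.x).y - (v.y).x on the basis.  Scalars stay on
   the left since K is commutative. *)
Record rmod := RMod {
  carrier :> lmodType K;
  act : sl2 -> carrier -> carrier;
  act_linear : forall x, linear (act x);
  act_EF : forall v, act F (act E v) - act E (act F v) = act H v;
  act_HE : forall v, act E (act H v) - act H (act E v) = 2%:R *: act E v;
  act_HF : forall v, act F (act H v) - act H (act F v) = - (2%:R *: act F v) }.

HB.instance Definition _ (N : rmod) (x : sl2) :=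
  GRing.isLinear.Build K N N _ (@act N x) (@act_linear N x).

Local Notation "v \act x" := (act x v) (at level 40, left associativity).

Record hom (M N : rmod) := Hom {
  hom_fun :> M -> N;
  hom_linear : linear hom_fun;
  hom_act : forall x v, hom_fun (v \act x) = hom_fun v \act x }.

HB.instance Definition _ (M N : rmod) (f : hom M N) :=
  GRing.isLinear.Build K M N _ (hom_fun f) (hom_linear f).

Definition isomorphic (M N : rmod) : Prop := exists f : hom M N, bijective f.

Definition short_exact (A B C : rmod) (i : hom A B) (p : hom B C) : Prop :=
  [/\ injective i, (forall y, p y = 0 <-> exists x, i x = y)
    & (forall z, exists y, p y = z)].

Definition has_short_exact (A B C : rmod) : Prop :=
  exists (i : hom A B) (p : hom B C), short_exact i p.

Definition seq_isomorphic (A B C A' B' C' : rmod)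
    (i : hom A B) (p : hom B C) (i' : hom A' B') (p' : hom B' C') : Prop :=
  exists (a : hom A A') (b : hom B B') (c : hom C C'),
    [/\ bijective a, bijective b, bijective c,
        (forall x, b (i x) = i' (a x)) & (forall y, c (p y) = p' (b y))].

(* N^-: the action of x is that of its image under the involution H |-> -H,
   E |-> F, F |-> E. *)
Definition twist_act (N : rmod) (x : sl2) (v : N) : N :=
  match x with E => v \act F | F => v \act E | H => - (v \act H) end.

Lemma twist_act_linear (N : rmod) x : linear (@twist_act N x).
Proof. by case: x => a u v /=; rewrite linearP // opprD scalerN. Qed.

Lemma twist_EF (N : rmod) (v : N) :
  twist_act F (twist_act E v) - twist_act E (twist_act F v) = twist_act H v.
Proof. by rewrite /= -act_EF opprB. Qed.

Lemma twist_HE (N : rmod) (v : N) :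
  twist_act E (twist_act H v) - twist_act H (twist_act E v)
  = 2%:R *: twist_act E v.
Proof.
by rewrite /= raddfN opprK -[RHS]opprK -act_HF opprB addrC.
Qed.

Lemma twist_HF (N : rmod) (v : N) :
  twist_act F (twist_act H v) - twist_act H (twist_act F v)
  = - (2%:R *: twist_act F v).
Proof. by rewrite /= raddfN opprK -act_HE opprB addrC. Qed.

Definition twist (N : rmod) : rmod :=
  RMod (@twist_act_linear N) (@twist_EF N) (@twist_HE N) (@twist_HF N).

Lemma twist_hom_act (M N : rmod) (f : hom M N) x (v : twist M) :
  f (v \act x) = (f v : twist N) \act x.
Proof. by case: x; rewrite /= ?raddfN /= hom_act. Qed.

Definition twist_hom (M N : rmod) (f : hom M N) : hom (twist M) (twist N) :=
  @Hom (twist M) (twist N) f (hom_linear f) (twist_hom_act f).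

(* For a weight module N, restriction to the weight spaces N_nu identifies the
   linear forms on N vanishing on all but finitely many N_nu with the direct sum
   of the Hom(N_nu, K), the underlying space of the dual N^v. *)
Definition restricted_form (N : rmod) (phi : N -> K^o) : bool :=
  `[< scalar phi /\ exists s : seq K,
        forall nu (v : N), v \act H = nu *: v -> nu \notin s -> phi v = 0 >].

Lemma restricted_form_submod (N : rmod) : submod_closed (@restricted_form N).
Proof.
split.
  apply/asboolP; split; last by exists [::].
  by move=> a u v; rewrite /= mulr0 addr0.
move=> a phi psi /asboolP[lphi [s hs]] /asboolP[lpsi [t ht]].
apply/asboolP; split.
  move=> b u v; rewrite !fctE lphi lpsi /=.
  rewrite scalerDr -addrA [X in _ + X]addrCA addrA; congr (_ + _).
  by rewrite mulrDr; congr (_ + _); rewrite /GRing.scale /= mulrCA.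
exists (s ++ t) => nu v wv; rewrite mem_cat negb_or => /andP[nus nut].
by rewrite !fctE (hs _ _ wv nus) (ht _ _ wv nut) scaler0 addr0.
Qed.

HB.instance Definition _ (N : rmod) :=
  GRing.isSubmodClosed.Build K (N -> K^o) (@restricted_form N)
    (@restricted_form_submod N).

Record dual_space (N : rmod) := DualSpace {
  dual_form :> N -> K^o;
  dual_formP : restricted_form dual_form }.

HB.instance Definition _ (N : rmod) := [isSub for @dual_form N].
HB.instance Definition _ (N : rmod) := [Choice of dual_space N by <:].
HB.instance Definition _ (N : rmod) :=
  GRing.SubChoice_isSubLmodule.Build K (N -> K^o) (@restricted_form N)
    (dual_space N) (@restricted_form_submod N).

(* The basis values of an anti-involution, so that (phi.x)(v) = phi(v.tau(x)) is
   again a right action. *)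
Definition tau (x : sl2) : sl2 := match x with E => F | F => E | H => H end.

Lemma dual_act_subproof (N : rmod) (x : sl2) (phi : dual_space N) :
  restricted_form (fun v : N => phi (v \act tau x)).
Proof.
case: phi => phi /= /asboolP[lphi [s hs]]; apply/asboolP; split.
  by move=> a u v; rewrite /= linearP lphi.
case: x => /=.
- exists [seq n - 2%:R | n <- s] => nu v wv nus.
  apply: (hs (nu + 2%:R)); last first.
    by apply: contra nus => ins; apply/mapP; exists (nu + 2%:R); rewrite ?addrK.
  have := act_HF v; rewrite wv linearZ /= => /eqP.
  by rewrite subr_eq addrC -subr_eq opprK -scalerDl => /eqP <-.
- exists [seq n + 2%:R | n <- s] => nu v wv nus.
  apply: (hs (nu - 2%:R)); last first.
    by apply: contra nus => ins; apply/mapP; exists (nu - 2%:R); rewrite ?subrK.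
  have := act_HE v; rewrite wv linearZ /= => /eqP.
  by rewrite subr_eq addrC -subr_eq -scalerBl => /eqP <-.
- by exists s => nu v wv nus; apply: (hs nu) => //; rewrite wv linearZ /= wv.
Qed.

Definition dual_act (N : rmod) (x : sl2) (phi : dual_space N) : dual_space N :=
  DualSpace (dual_act_subproof x phi).

Lemma dual_act_linear (N : rmod) x : linear (@dual_act N x).
Proof. by move=> a phi psi; apply/val_inj. Qed.

Lemma dual_formB (N : rmod) (phi : dual_space N) u v :
  phi (u - v) = phi u - phi v.
Proof.
have /asboolP[lphi _] := dual_formP phi.
by rewrite addrC -scaleN1r lphi /= mulN1r addrC.
Qed.

Lemma dual_formZ (N : rmod) (phi : dual_space N) a u : phi (a *: u) = a * phi u.
Proof.
have /asboolP[lphi _] := dual_formP phi.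
have phi0 : phi 0 = 0 by have := dual_formB phi 0 0; rewrite !subrr.
by have := lphi a u 0; rewrite phi0 !addr0.
Qed.

Lemma dual_EF (N : rmod) (phi : dual_space N) :
  dual_act F (dual_act E phi) - dual_act E (dual_act F phi) = dual_act H phi.
Proof.
by apply/val_inj/funext => v; rewrite /= !fctE /= -dual_formB act_EF.
Qed.

Lemma dual_HE (N : rmod) (phi : dual_space N) :
  dual_act E (dual_act H phi) - dual_act H (dual_act E phi)
  = 2%:R *: dual_act E phi.
Proof.
apply/val_inj/funext => v; rewrite /= !fctE /= -dual_formB.
by rewrite -opprB act_HF opprK dual_formZ.
Qed.

Lemma dual_HF (N : rmod) (phi : dual_space N) :
  dual_act F (dual_act H phi) - dual_act H (dual_act F phi)
  = - (2%:R *: dual_act F phi).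
Proof.
apply/val_inj/funext => v; rewrite /= !fctE /= -dual_formB.
by rewrite -opprB act_HE -scaleNr dual_formZ mulNr.
Qed.

Definition dual (N : rmod) : rmod :=
  RMod (@dual_act_linear N) (@dual_EF N) (@dual_HE N) (@dual_HF N).

Lemma dual_hom_subproof (M N : rmod) (f : hom M N) (phi : dual_space N) :
  restricted_form (fun v : M => phi (f v)).
Proof.
case: phi => phi /= /asboolP[lphi [s hs]]; apply/asboolP; split.
  by move=> a u v; rewrite /= linearP lphi.
by exists s => nu v wv; apply: hs; rewrite -hom_act wv linearZ.
Qed.

Definition dual_fun (M N : rmod) (f : hom M N) (phi : dual N) : dual M :=
  DualSpace (dual_hom_subproof f phi).

Lemma dual_fun_linear (M N : rmod) (f : hom M N) : linear (dual_fun f).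
Proof. by move=> a phi psi; apply/val_inj. Qed.

Lemma dual_fun_act (M N : rmod) (f : hom M N) x (phi : dual N) :
  dual_fun f (phi \act x) = dual_fun f phi \act x.
Proof. by apply/val_inj/funext => v; rewrite /= hom_act. Qed.

Definition dual_hom (M N : rmod) (f : hom M N) : hom (dual N) (dual M) :=
  Hom (dual_fun_linear f) (dual_fun_act f).

(* M(mu) in its basis v.F^n = 'X^n, where v.E = 0, v.H = - mu v and hence
   v.F^n.E = n (mu - n + 1) v.F^(n-1), v.F^n.H = (2n - mu) v.F^n. *)
Definition verma_act (mu : K) (x : sl2) (p : {poly K}) : {poly K} :=
  match x with
  | E => mu *: p^`() - 'X * p^`()^`()
  | F => 'X * p
  | H => 2%:R *: ('X * p^`()) - mu *: p
  end.

Lemma verma_act_linear mu x : linear (verma_act mu x).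
Proof.
by case: x => a p q /=; rewrite ?derivE -!mul_polyC; ring.
Qed.

Lemma verma_EF mu p :
  verma_act mu F (verma_act mu E p) - verma_act mu E (verma_act mu F p)
  = verma_act mu H p.
Proof. by rewrite /= !derivE -!mul_polyC polyC_natr; ring. Qed.

Lemma verma_HE mu p :
  verma_act mu E (verma_act mu H p) - verma_act mu H (verma_act mu E p)
  = 2%:R *: verma_act mu E p.
Proof. by rewrite /= !derivE -!mul_polyC polyC_natr; ring. Qed.

Lemma verma_HF mu p :
  verma_act mu F (verma_act mu H p) - verma_act mu H (verma_act mu F p)
  = - (2%:R *: verma_act mu F p).
Proof. by rewrite /= !derivE -!mul_polyC polyC_natr; ring. Qed.

Definition verma (mu : K) : rmod :=
  RMod (@verma_act_linear mu) (@verma_EF mu) (@verma_HE mu) (@verma_HF mu).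

Lemma verma_E1 mu : act E (1 : verma mu) = 0.
Proof. by rewrite /= !derivE mulr0 scaler0 subr0. Qed.

Lemma verma_H1 mu : act H (1 : verma mu) = - mu *: (1 : verma mu).
Proof. by rewrite /= !derivE mulr0 scaler0 sub0r scaleNr. Qed.

Lemma verma_FXn mu n : act F ('X^n : verma mu) = 'X^(n.+1).
Proof. by rewrite /= exprS. Qed.

End RightModules.

Arguments act {K r} x v.
Notation "v '\act' x" := (act x v) (at level 40, left associativity).

Record lsubmod (K : pzRingType) (V : lmodType K) := LSubmod {
  lsubmod_pred :> {pred V};
  lsubmodP : submod_closed lsubmod_pred }.

HB.instance Definition _ (K : pzRingType) (V : lmodType K) (S : lsubmod V) :=
  GRing.isZmodClosed.Build V (lsubmod_pred S) (GRing.submod_closedB (lsubmodP S)).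
HB.instance Definition _ (K : pzRingType) (V : lmodType K) (S : lsubmod V) :=
  GRing.isScaleClosed.Build K V (lsubmod_pred S)
    (GRing.subsemimod_closedZ (GRing.submod_closed_semi (lsubmodP S))).

Section LmodQuotient.
Variables (K : pzRingType) (V : lmodType K) (S : lsubmod V).

Let I : zmodClosed V := GRing.ZmodClosed.clone V (lsubmod_pred S) _.

Definition lquot : Type := Quotient.quot I.
HB.instance Definition _ := GRing.Zmodule.on lquot.
HB.instance Definition _ := EqQuotient.on lquot.

Lemma lquotE (u v : V) : \pi_lquot u = \pi_lquot v <-> u - v \in S.
Proof. by rewrite (Quotient.idealrBE I); split=> [->|/eqP]. Qed.

Lemma pi_lquotD (u v : V) : \pi_lquot (u + v) = \pi_lquot u + \pi_lquot v.
Proof. exact: (@pi_addr _ _ _ _ _ (Quotient.quot I)). Qed.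

Definition lquot_map (f : V -> V) (u : lquot) : lquot := \pi_lquot (f (repr u)).

Lemma pi_lquot_map (f : {linear V -> V}) :
  (forall v, v \in S -> f v \in S) ->
  forall u, lquot_map f (\pi_lquot u) = \pi_lquot (f u).
Proof.
by move=> fS u; apply/lquotE; rewrite -linearB fS //; apply/lquotE; rewrite reprK.
Qed.

Definition lquot_scale (a : K) (u : lquot) : lquot := \pi_lquot (a *: repr u).

Lemma pi_lquotZ a (u : V) : lquot_scale a (\pi_lquot u) = \pi_lquot (a *: u).
Proof.
by apply/lquotE; rewrite -scalerBr rpredZ //; apply/lquotE; rewrite reprK.
Qed.

Fact lquot_scaleA a b (u : lquot) :
  lquot_scale a (lquot_scale b u) = lquot_scale (a * b) u.
Proof. by elim/quotW: u => u; rewrite (pi_lquotZ b u) !pi_lquotZ scalerA. Qed.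

Fact lquot_scale1 : left_id 1 lquot_scale.
Proof. by move=> u; elim/quotW: u => u; rewrite !pi_lquotZ scale1r. Qed.

Fact lquot_scaleDr : right_distributive lquot_scale +%R.
Proof.
move=> a u v; elim/quotW: u => u; elim/quotW: v => v.
by rewrite -pi_lquotD !pi_lquotZ scalerDr pi_lquotD.
Qed.

Fact lquot_scaleDl u : {morph lquot_scale^~ u : a b / a + b}.
Proof.
by move=> a b; elim/quotW: u => u; rewrite !pi_lquotZ scalerDl pi_lquotD.
Qed.

HB.instance Definition _ := GRing.Zmodule_isLmodule.Build K lquot
  lquot_scaleA lquot_scale1 lquot_scaleDr lquot_scaleDl.

Lemma pi_lquot_linear : linear \pi_lquot.
Proof. by move=> a u v; rewrite pi_lquotD -pi_lquotZ. Qed.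

End LmodQuotient.

Section QuotientModule.
Variables (K : fieldType) (N : rmod K) (S : lsubmod N).
Hypothesis S_act : forall x v, v \in S -> v \act x \in S.

Let pi : {linear N -> lquot S} :=
  HB.pack (\pi_(lquot S))
    (GRing.isLinear.Build K N (lquot S) _ \pi_(lquot S) (@pi_lquot_linear _ _ S)).

Definition quot_act (x : sl2) : lquot S -> lquot S := lquot_map (@act K N x).

Lemma pi_quot_act x (v : N) : quot_act x (pi v) = pi (v \act x).
Proof. exact: (pi_lquot_map (@S_act x)). Qed.

Lemma quot_act_linear x : linear (quot_act x).
Proof.
move=> a u v; elim/quotW: u => u; elim/quotW: v => v.
by rewrite -[\pi u]/(pi u) -[\pi v]/(pi v) -linearP !pi_quot_act !linearP.
Qed.

Lemma quot_EF u :
  quot_act F (quot_act E u) - quot_act E (quot_act F u) = quot_act H u.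
Proof.
by elim/quotW: u => v; rewrite -[\pi v]/(pi v) !pi_quot_act -act_EF linearB.
Qed.

Lemma quot_HE u :
  quot_act E (quot_act H u) - quot_act H (quot_act E u) = 2%:R *: quot_act E u.
Proof.
elim/quotW: u => v; rewrite -[\pi v]/(pi v) !pi_quot_act.
by rewrite -linearB act_HE linearZ.
Qed.

Lemma quot_HF u :
  quot_act F (quot_act H u) - quot_act H (quot_act F u)
  = - (2%:R *: quot_act F u).
Proof.
elim/quotW: u => v; rewrite -[\pi v]/(pi v) !pi_quot_act.
by rewrite -linearB act_HF linearN linearZ.
Qed.

Definition quot_mod : rmod K := RMod quot_act_linear quot_EF quot_HE quot_HF.

End QuotientModule.

Section Regular.
Variables (K : fieldType) (A : algType K) (g : sl2 -> A).
Hypothesis g_EF : g E * g F - g F * g E = g H.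
Hypothesis g_HE : g H * g E - g E * g H = 2%:R *: g E.
Hypothesis g_HF : g H * g F - g F * g H = - (2%:R *: g F).

Definition reg_act (x : sl2) (u : A) : A := u * g x.

Lemma reg_act_linear x : linear (reg_act x).
Proof. by move=> a u v; rewrite /reg_act mulrDl scalerAl. Qed.

Lemma reg_EF u :
  reg_act F (reg_act E u) - reg_act E (reg_act F u) = reg_act H u.
Proof. by rewrite /reg_act -!mulrA -mulrBr g_EF. Qed.

Lemma reg_HE u :
  reg_act E (reg_act H u) - reg_act H (reg_act E u) = 2%:R *: reg_act E u.
Proof. by rewrite /reg_act -!mulrA -mulrBr g_HE scalerAr. Qed.

Lemma reg_HF u :
  reg_act F (reg_act H u) - reg_act H (reg_act F u) = - (2%:R *: reg_act F u).
Proof. by rewrite /reg_act -!mulrA -mulrBr g_HF mulrN scalerAr. Qed.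

Definition reg_mod : rmod K := RMod reg_act_linear reg_EF reg_HE reg_HF.

Definition rideal2 (r s u : A) : bool := `[< exists a b, u = r * a + s * b >].

Lemma rideal2_submod r s : submod_closed (rideal2 r s).
Proof.
split=> [|c u v /asboolP[a [b ->]] /asboolP[a' [b' ->]]]; apply/asboolP.
  by exists 0, 0; rewrite !mulr0 addr0.
exists (c *: a + a'), (c *: b + b').
by rewrite scalerDr !mulrDr !scalerAr addrACA.
Qed.

Definition rideal2_lsubmod r s : lsubmod reg_mod :=
  @LSubmod K reg_mod _ (rideal2_submod r s).

Lemma rideal2_act r s x (u : reg_mod) :
  u \in rideal2_lsubmod r s -> u \act x \in rideal2_lsubmod r s.
Proof.
move=> /asboolP[a [b ->]]; apply/asboolP.
by exists (a * g x), (b * g x); rewrite !mulrA /= /reg_act mulrDl.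
Qed.

(* A modulo the right ideal generated by r and s. *)
Definition cyclic2 (r s : A) : rmod K := quot_mod (@rideal2_act r s).

End Regular.

Section MalgComplements.
Variables (M : monomType) (K : comNzRingType).
Implicit Types p q r s : {malg K[M]}.

Lemma malg_scaleAr (a : K) p q : a *: (p * q) = p * (a *: q).
Proof.
apply/malgP => k; rewrite (mcoeffZ a (p * q)) (mcoeffMl p q).
rewrite (mcoeffMlw k (finmap.fsubset_refl _) (msuppZ_le a q)) mulr_sumr.
apply: eq_bigr => k1 _; rewrite mulr_sumr; apply: eq_bigr => k2 _.
by rewrite (mcoeffZ a q) mulrnAr mulrCA.
Qed.

Lemma mcoeff1M p q : mcoeff mone (p * q) = mcoeff mone p * mcoeff mone q.
Proof. exact: rmorphM. Qed.

Lemma mcoeff1_commD p q r : mcoeff mone p = 0 -> mcoeff mone r = 0 ->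
  mcoeff mone (p * q - q * p + r) = 0.
Proof.
move=> hp hr; rewrite mcoeffD hr mcoeffB (mcoeff1M p q) (mcoeff1M q p).
by rewrite hp mul0r mulr0 subr0 addr0.
Qed.

End MalgComplements.

Section Enveloping.
Variable K : fieldType.

(* [env] is the enveloping algebra U(sl_2): the free associative algebra on the
   basis of sl_2 modulo the two-sided ideal of the commutation relations. *)
Definition freealg : lalgType K := {malg K[{fmonom sl2}]}.

Definition freegen (x : sl2) : freealg := mkmalgU (fmu x) 1.

Inductive env_ideal : freealg -> Prop :=
| env_EF : env_ideal (freegen E * freegen F - freegen F * freegen E - freegen H)
| env_HE : env_ideal
    (freegen H * freegen E - freegen E * freegen H - 2%:R *: freegen E)
| env_HF : env_ideal
    (freegen H * freegen F - freegen F * freegen H + 2%:R *: freegen F)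
| env_add p q : env_ideal p -> env_ideal q -> env_ideal (p + q)
| env_mull a p : env_ideal p -> env_ideal (a * p)
| env_mulr p a : env_ideal p -> env_ideal (p * a).

Lemma freealg_scaleAr (a : K) (p q : freealg) : a *: (p * q) = p * (a *: q).
Proof. exact: malg_scaleAr. Qed.

Lemma env_ideal_mcoeff1 (p : freealg) : env_ideal p -> mcoeff mone p = 0.
Proof.
have gen0 x : mcoeff mone (freegen x) = 0.
  by rewrite [LHS]mcoeffU1 fm1_eq1.
have gen0Z a x : mcoeff mone (a *: freegen x) = 0.
  by rewrite [LHS]mcoeffZ gen0 mulr0.
elim=> {p} [|||p q _ hp _ hq|a p _ hp|p a _ hp].
- by apply: mcoeff1_commD => //; rewrite [LHS]mcoeffN gen0 oppr0.
- by apply: mcoeff1_commD => //; rewrite [LHS]mcoeffN gen0Z oppr0.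
- by apply: mcoeff1_commD => //; apply: gen0Z.
- by rewrite [LHS]mcoeffD hp hq addr0.
- by rewrite [LHS]mcoeff1M hp mulr0.
- by rewrite [LHS]mcoeff1M hp mul0r.
Qed.

Lemma env_ideal_proper : ~ env_ideal 1.
Proof.
by move/env_ideal_mcoeff1; rewrite [LHS]mcoeff1 eqxx => /eqP; rewrite oner_eq0.
Qed.

Lemma env_ideal_submod : submod_closed (fun p : freealg => `[< env_ideal p >]).
Proof.
split=> [|a p q /asboolP Ip /asboolP Iq]; apply/asboolP.
  by rewrite -[0](mul0r (freegen E * freegen F - freegen F * freegen E
                       - freegen H)); apply/env_mull/env_EF.
by apply: env_add => //; rewrite -mulr_algl; apply: env_mull.
Qed.

Definition env_submod : lsubmod freealg := LSubmod env_ideal_submod.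

Definition env_space : Type := lquot env_submod.
HB.instance Definition _ := GRing.Lmodule.on env_space.
HB.instance Definition _ := EqQuotient.on env_space.

Let pi (p : freealg) : env_space := \pi_env_space p.

Let piE (p q : freealg) : pi p = pi q <-> env_ideal (p - q).
Proof. by rewrite /pi (lquotE env_submod) unfold_in /=; split=> /asboolP. Qed.

Let piW (P : env_space -> Prop) : (forall p, P (pi p)) -> forall u, P u.
Proof. by move=> Ppi u; rewrite -(reprK u); apply: Ppi. Qed.

Let pi_linear : linear pi.
Proof. exact: pi_lquot_linear. Qed.

Let piD p q : pi (p + q) = pi p + pi q.
Proof. exact: pi_lquotD. Qed.

Let piZ a p : a *: pi p = pi (a *: p).
Proof. exact: pi_lquotZ. Qed.

Definition env_one : env_space := pi 1.
Definition env_mul (u v : env_space) : env_space := pi (repr u * repr v).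

Let piM p q : env_mul (pi p) (pi q) = pi (p * q).
Proof.
apply/piE; set p' := repr _; set q' := repr _.
have -> : p' * q' - p * q = (p' - p) * q' + p * (q' - q).
  by rewrite mulrBl mulrBr addrA subrK.
by apply: env_add; [apply: env_mulr | apply: env_mull]; apply/piE;
   rewrite /pi reprK.
Qed.

Fact env_mulA : associative env_mul.
Proof.
by elim/piW => p; elim/piW => q; elim/piW => r; rewrite !piM mulrA.
Qed.

Fact env_mul1l : left_id env_one env_mul.
Proof. by elim/piW => p; rewrite piM mul1r. Qed.

Fact env_mul1r : right_id env_one env_mul.
Proof. by elim/piW => p; rewrite piM mulr1. Qed.

Fact env_mulDl : left_distributive env_mul +%R.
Proof.
elim/piW => p; elim/piW => q; elim/piW => r.
by rewrite -piD !piM mulrDl piD.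
Qed.

Fact env_mulDr : right_distributive env_mul +%R.
Proof.
elim/piW => p; elim/piW => q; elim/piW => r.
by rewrite -piD !piM mulrDr piD.
Qed.

Fact env_oner_neq0 : env_one != 0.
Proof.
apply/eqP; rewrite -(scale0r (pi 0)) piZ => /piE.
by rewrite scaler0 subr0 => /env_ideal_proper.
Qed.

HB.instance Definition _ := GRing.Zmodule_isNzRing.Build env_space
  env_mulA env_mul1l env_mul1r env_mulDl env_mulDr env_oner_neq0.

Fact env_scaleAl (a : K) (u v : env_space) : a *: (u * v) = a *: u * v.
Proof.
elim/piW: u => p; elim/piW: v => q; rewrite [_ * _]piM !piZ [RHS]piM.
by rewrite scalerAl.
Qed.

HB.instance Definition _ :=
  GRing.Lmodule_isLalgebra.Build K env_space env_scaleAl.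

Fact env_scaleAr (a : K) (u v : env_space) : a *: (u * v) = u * (a *: v).
Proof.
elim/piW: u => p; elim/piW: v => q; rewrite [_ * _]piM !piZ [RHS]piM.
by rewrite freealg_scaleAr.
Qed.

HB.instance Definition _ :=
  GRing.Lalgebra_isAlgebra.Build K env_space env_scaleAr.

Fact env_pi_monoid_morphism : monoid_morphism pi.
Proof. by split; [exact: erefl | move=> p q; symmetry; exact: piM]. Qed.

Fact env_pi_surj u : exists p, pi p = u.
Proof. by elim/piW: u => p; exists p. Qed.

(* [pres_alg] is the quotient of the free algebra by [env_ideal]. *)
Record presentation := Presentation {
  pres_alg : algType K;
  pres_pi : freealg -> pres_alg;
  pres_linear : linear pres_pi;
  pres_monoid_morphism : monoid_morphism pres_pi;
  pres_eq : forall p q, pres_pi p = pres_pi q <-> env_ideal (p - q);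
  pres_surj : forall u, exists p, pres_pi p = u }.

(* Opaque, so that unification never unfolds the construction. *)
Fact sl2_presentation : presentation.
Proof.
exact: (@Presentation env_space pi pi_linear env_pi_monoid_morphism piE
  env_pi_surj).
Qed.

Definition env : algType K := pres_alg sl2_presentation.

Definition env_pi (p : freealg) : env := pres_pi sl2_presentation p.

Lemma env_pi_eq p q : env_pi p = env_pi q <-> env_ideal (p - q).
Proof. exact: pres_eq. Qed.

Lemma env_pi_surjective u : exists p, env_pi p = u.
Proof. exact: pres_surj. Qed.

HB.instance Definition _ :=
  GRing.isLinear.Build K freealg env _ env_pi (pres_linear sl2_presentation).
HB.instance Definition _ :=
  GRing.isMonoidMorphism.Build freealg env env_pi
    (pres_monoid_morphism sl2_presentation).

Definition envgen (x : sl2) : env := env_pi (freegen x).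

Lemma envgen_EF : envgen E * envgen F - envgen F * envgen E = envgen H.
Proof. by rewrite -!rmorphM -rmorphB; apply/env_pi_eq/env_EF. Qed.

Lemma envgen_HE :
  envgen H * envgen E - envgen E * envgen H = 2%:R *: envgen E.
Proof. by rewrite -!rmorphM -rmorphB -linearZ; apply/env_pi_eq/env_HE. Qed.

Lemma envgen_HF :
  envgen H * envgen F - envgen F * envgen H = - (2%:R *: envgen F).
Proof.
rewrite -!rmorphM -rmorphB -linearZ -raddfN; apply/env_pi_eq.
by rewrite opprK; apply: env_HF.
Qed.

(* R(l, a) *)
Definition Rmod (l : int) (a : K) : rmod K :=
  cyclic2 envgen_EF envgen_HE envgen_HF
    (envgen H + (2%:R * a + l%:~R)%:A)
    (envgen E * envgen F + ((a + l%:~R) * (a + 1))%:A).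

End Enveloping.

Section Classes.
Variable K : fieldType.

Local Notation R l a := (@Rmod K l a%:~R).

(* There are exactly [size ranges] isomorphism classes of modules R(l, a) with a
   an integer, given by the listed ranges of a: the ranges are nonempty, cover
   all integers, and two modules are isomorphic iff they come from one range. *)
Definition exact_classes (l : int) (ranges : seq (pred int)) : Prop :=
  [/\ forall i, (i < size ranges)%N -> exists a, nth xpred0 ranges i a,
      forall a, exists2 i, (i < size ranges)%N & nth xpred0 ranges i a
    & forall i j a b, (i < size ranges)%N -> (j < size ranges)%N ->
        nth xpred0 ranges i a -> nth xpred0 ranges j b ->
        (isomorphic (R l a) (R l b) <-> i = j)].

(* R(l, a) is of type <, >, = respectively; there is no type = for l = 1. *)
Definition lt_type (l a : int) : bool := if 2 <= l then a <= - l else a <= -1.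
Definition gt_type (l a : int) : bool := if l <= 0 then 1 - l <= a else 0 <= a.
Definition eq_type (l a : int) : bool :=
  if 2 <= l then 1 - l <= a <= -1 else (l <= 0) && (0 <= a <= - l).

(* The exact sequences are named in the statement by their terms only; the
   functor is required to exchange any two sequences with the given terms. *)
Definition twist_exchanges (A B C A' B' C' : rmod K) : Prop :=
  forall (i : hom A B) (p : hom B C) (i' : hom A' B') (p' : hom B' C'),
    short_exact i p -> short_exact i' p' ->
    seq_isomorphic (twist_hom i) (twist_hom p) i' p' /\
    seq_isomorphic (twist_hom i') (twist_hom p') i p.

Definition dual_exchanges (A B C A' B' C' : rmod K) : Prop :=
  forall (i : hom A B) (p : hom B C) (i' : hom A' B') (p' : hom B' C'),
    short_exact i p -> short_exact i' p' ->
    seq_isomorphic (dual_hom p) (dual_hom i) i' p' /\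
    seq_isomorphic (dual_hom p') (dual_hom i') i p.

End Classes.

Arguments exact_classes K l ranges : clear implicits.

(* Main.v *)
From HB Require Import structures.
From mathcomp Require Import all_boot all_order all_algebra.
From mathcomp Require Import reals complex.
From mathcomp Require Import finmap generic_quotient boolp functions.
From mathcomp Require Import monalg ring zify.
Require Import Defs.

(* Every module of the statement has one-dimensional weight spaces with integral
   weights, so it is described by the set of its weights and by the scalars by
   which E and F act between chosen weight vectors.  Homomorphisms are diagonal
   in such bases, and injectivity, surjectivity and exactness only depend on
   which diagonal entries vanish.  All modules attached to l have the same
   Casimir scalar, so on the weight space of weight n the operator EF is the
   scalar kappa(n) = -(n-l)(n+l-2)/4, which vanishes only for n = l and
   n = 2-l.  Hence R(l,a) is determined by whether E or F vanishes on the two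
   links n -> n-2 with n = l, 2-l: as its generator has weight w0 = -(2a+l), it
   is F if n <= w0, and E otherwise.  The maps come from the universal
   properties of R(l,a) and of Verma modules; that the weight spaces of R(l,a)
   do not collapse is seen on an explicit model. *)

Set Implicit Arguments.
Unset Strict Implicit.
Unset Printing Implicit Defensive.

Import Order.TTheory GRing.Theory Num.Theory.

Local Open Scope ring_scope.
Local Open Scope quotient_scope.

(** In a right module [E] lowers weights by 2 and [F] raises them. Two difficulties shape the proof.
    A presentation may define a smaller module than expected, so the basis of R(l,a) is pinned down
    from both sides: the relations give spanning vectors, the model gives coordinate functions on
    them. And exchange is required for every pair of exact sequences with the prescribed terms; it
    holds because images and kernels are spanned by weight vectors, so an isomorphism of the middle
    terms matches the submodules as soon as these have the same weights. The set {l, 2-l} of links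
    is unchanged by l -> 2-l, whence (4), and its two elements coincide exactly for l = 1, where the
    type = disappears. The hypothesis [K0] is characteristic zero: it keeps integral weights
    apart. *)

(** * Action of the enveloping algebra on a right module *)

Section FreeAction.
Variables (K : fieldType) (N : rmod K).

Definition word_act (v : N) (s : seq sl2) : N :=
  foldl (fun u x => u \act x) v s.

Lemma word_act_linear s : linear (word_act^~ s).
Proof. by elim: s => //= x s IHs a u v; rewrite linearP IHs. Qed.

Definition free_act (v : N) (p : freealg K) : N :=
  \sum_(k <- msupp p) mcoeff k p *: word_act v k.

Lemma free_actEw (d : {fset {fmonom sl2}}) v (p : freealg K) :
  fsubset (msupp p) d ->
  free_act v p = \sum_(k <- d) mcoeff k p *: word_act v k.
Proof.
move=> le_pd; rewrite /free_act (big_fset_incl _ le_pd) // => k _.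
by move=> /mcoeff_outdom->; rewrite scale0r.
Qed.

Lemma free_act_linear v : linear (free_act v).
Proof.
move=> a p q; pose d := fsetU (msupp p) (fsetU (msupp q) (msupp (a *: p + q))).
have [lep leq ler] : [/\ fsubset (msupp p) d, fsubset (msupp q) d
    & fsubset (msupp (a *: p + q)) d].
  split; first exact: fsubsetUl.
    exact: (fsubset_trans (fsubsetUl _ _) (fsubsetUr _ _)).
  exact: (fsubset_trans (fsubsetUr _ _) (fsubsetUr _ _)).
rewrite (free_actEw v lep) (free_actEw v leq) (free_actEw v ler).
rewrite scaler_sumr -big_split /=; apply: eq_bigr => k _.
rewrite [mcoeff k (_ + _)]mcoeffD [mcoeff k (a *: p)]mcoeffZ.
by rewrite scalerDl scalerA.
Qed.

HB.instance Definition _ v :=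
  GRing.isLinear.Build K (freealg K) N _ (free_act v) (free_act_linear v).

Lemma free_act_vlinear p : linear (free_act^~ p).
Proof.
move=> a u v; rewrite /free_act scaler_sumr -big_split /=.
apply: eq_bigr => k _.
by rewrite word_act_linear scalerDr !scalerA mulrC.
Qed.

Lemma free_act0 p : free_act 0 p = 0.
Proof.
rewrite -[0 in LHS](subrr (0 : N)) -scaleN1r addrC free_act_vlinear.
by rewrite scaleN1r addNr.
Qed.

Lemma free_actU v (c : K) k : free_act v (mkmalgU k c) = c *: word_act v k.
Proof.
by rewrite (@free_actEw [fset k]%fset) ?msuppU_le // big_seq_fset1 mcoeffUU.
Qed.

Lemma free_act1 v : free_act v 1 = v.
Proof. by rewrite [LHS]free_actU fm1 scale1r. Qed.

Lemma free_act_gen v x : free_act v (freegen K x) = v \act x.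
Proof. by rewrite free_actU fmU scale1r. Qed.

(** In a right module the letters of a word act in reading order, so concatenation is successive
    action; bilinearity does the rest. *)
Lemma free_actM v p q : free_act v (p * q) = free_act (free_act v p) q.
Proof.
rewrite [p * q]malgME (linear_sum (free_act v)) /=.
rewrite {2}/free_act.
pose h u : N := free_act u q.
have hl : linear h by move=> a u w; rewrite /h free_act_vlinear.
pose hL : {linear N -> N} := HB.pack h (GRing.isLinear.Build K N N _ h hl).
rewrite -[RHS]/(hL _) linear_sum; apply: eq_bigr => k _.
rewrite (linear_sum (free_act v)) linearZ /= /h /free_act scaler_sumr.
apply: eq_bigr => k' _; rewrite -/(free_act _ _) free_actU scalerA fmM.
by rewrite /word_act foldl_cat.
Qed.

Lemma free_actD v p q : free_act v (p + q) = free_act v p + free_act v q.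
Proof. exact: linearD. Qed.

Lemma free_actB v p q : free_act v (p - q) = free_act v p - free_act v q.
Proof. exact: linearB. Qed.

Lemma free_actZ v c p : free_act v (c *: p) = c *: free_act v p.
Proof. exact: linearZ. Qed.

Lemma free_act_comm v p q r :
  free_act v (p * q - q * p + r)
  = free_act (free_act v p) q - free_act (free_act v q) p + free_act v r.
Proof.
by rewrite free_actD; congr (_ + _); rewrite free_actB; congr (_ - _);
   apply: free_actM.
Qed.

Lemma env_ideal_act v p : env_ideal p -> free_act v p = 0.
Proof.
have genN w x : free_act w (- freegen K x) = - (w \act x).
  by rewrite [LHS]linearN; congr (- _); apply: free_act_gen.
have genZ w a x : free_act w (a *: freegen K x) = a *: (w \act x).
  by rewrite free_actZ free_act_gen.
(* The vector stays general: for a left multiple [a * p] the induction hypothesis is needed at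
   [free_act v a]. *)
move=> Ip; elim: Ip v => {p} [|||p q _ hp _ hq|a p _ hp|p a _ hp] v.
- by rewrite free_act_comm genN !free_act_gen act_EF subrr.
- rewrite free_act_comm -scaleNr genZ !free_act_gen act_HE.
  by rewrite scaleNr subrr.
- by rewrite free_act_comm genZ !free_act_gen act_HF addNr.
- by rewrite free_actD (hp v) (hq v) addr0.
- by rewrite free_actM (hp (free_act v a)).
- by rewrite free_actM (hp v) free_act0.
Qed.

(** Acts through an arbitrary preimage in the free algebra; [env_act_pi] shows that the choice is
    immaterial. *)
Definition env_act (v : N) (u : env K) : N :=
  free_act v (projT1 (cid (env_pi_surjective u))).

Lemma env_act_pi v p : env_act v (env_pi p) = free_act v p.
Proof.
rewrite /env_act; case: cid => q /= /env_pi_eq /(env_ideal_act v).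
by rewrite linearB => /eqP; rewrite subr_eq0 => /eqP.
Qed.

Lemma env_act_linear v : linear (env_act v).
Proof.
move=> a u w; have [p <-] := env_pi_surjective u.
have [q <-] := env_pi_surjective w.
by rewrite -linearP !env_act_pi linearP.
Qed.

HB.instance Definition _ v :=
  GRing.isLinear.Build K (env K) N _ (env_act v) (env_act_linear v).

Lemma env_act1 v : env_act v 1 = v.
Proof. by rewrite -(rmorph1 (@env_pi K)) env_act_pi free_act1. Qed.

Lemma env_act_gen v x : env_act v (envgen K x) = v \act x.
Proof. by rewrite env_act_pi free_act_gen. Qed.

Lemma env_actM v u w : env_act v (u * w) = env_act (env_act v u) w.
Proof.
have [p <-] := env_pi_surjective u; have [q <-] := env_pi_surjective w.
by rewrite -rmorphM !env_act_pi free_actM.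
Qed.

Lemma env_act0 u : env_act 0 u = 0.
Proof. by have [p <-] := env_pi_surjective u; rewrite env_act_pi free_act0. Qed.

End FreeAction.

(** * Universal property of R(l,a) *)

Section Cyclic.
Variables (K : fieldType) (l : int) (a : K).
Local Notation Q := (Rmod l a).

Definition Rpi (u : env K) : Q := \pi_(lquot _) u.

Lemma Rpi_linear : linear Rpi. Proof. exact: pi_lquot_linear. Qed.

HB.instance Definition _ := GRing.isLinear.Build K (env K) Q _ Rpi Rpi_linear.

Lemma Rpi_eq u w : Rpi u = Rpi w <-> exists b c,
  u - w = (envgen K H + (2%:R * a + l%:~R)%:A) * b
        + (envgen K E * envgen K F + ((a + l%:~R) * (a + 1))%:A) * c.
Proof. by split=> [/lquotE/asboolP//|h]; apply/lquotE/asboolP. Qed.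

Lemma Rpi_surj u : exists w, Rpi w = u.
Proof. by exists (repr u); apply: reprK. Qed.

Lemma Rpi_act x u : Rpi u \act x = Rpi (u * envgen K x).
Proof.
exact: (pi_quot_act (@rideal2_act _ _ _ (envgen_EF K) (envgen_HE K)
  (envgen_HF K) _ _)).
Qed.

Definition Rgen : Q := Rpi 1.

Lemma Rgen_H : Rgen \act H = - (2%:R * a + l%:~R) *: Rgen.
Proof.
rewrite Rpi_act mul1r -linearZ /=; apply/Rpi_eq; exists 1, 0.
by rewrite mulr1 mulr0 addr0 scaleNr opprK.
Qed.

Lemma Rgen_EF : Rgen \act E \act F = - ((a + l%:~R) * (a + 1)) *: Rgen.
Proof.
rewrite /Rgen 2!Rpi_act mul1r -linearZ /=; apply/Rpi_eq; exists 0, 1.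
by rewrite mulr1 mulr0 add0r scaleNr opprK.
Qed.

(** Words in the basis of sl_2 span the free algebra, hence their classes span the quotient. Words
    are built from the right end because the action multiplies on the right. *)
Lemma Rgen_ind (P : Q -> Prop) :
  P Rgen -> (forall c u v, P u -> P v -> P (c *: u + v)) ->
  (forall x u, P u -> P (u \act x)) -> forall u, P u.
Proof.
move=> Pgen Plin Pact u; have [w <-] := Rpi_surj u.
have P0 : P 0 by rewrite -(addNr Rgen) -scaleN1r; apply: Plin.
have [p <-] := env_pi_surjective w.
have Pword s : P (Rpi (env_pi (mkmalgU (FMonom s) 1))).
  elim/last_ind: s => [|s x Ps]; first by rewrite -fmoneE (rmorph1 (@env_pi K)).
  have -> : mkmalgU (FMonom (rcons s x)) 1
      = (mkmalgU (FMonom s) 1 : freealg K) * freegen K x.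
    rewrite [RHS]fgmulUU mulr1; congr (mkmalgU _ _).
    by rewrite -cats1 -[RHS]/(fmmul _ _) fmmulE fmuE.
  by rewrite (rmorphM (@env_pi K)) -Rpi_act; apply: Pact.
rewrite (monalgE p); elim/big_rec: _ => [|k q _ Pq].
  by rewrite (linear0 (@env_pi K)) linear0.
have -> : mkmalgU k (mcoeff k p) = mcoeff k p *: (mkmalgU k 1 : freealg K).
  apply/malgP => k'; rewrite [RHS](mcoeffZ _ (mkmalgU k 1)).
  by rewrite !mcoeffU mulrnAr mulr1.
rewrite (linearP (@env_pi K)) linearP; apply: Plin => //.
by rewrite -(fmK k); apply: Pword.
Qed.

(** The two equations say that the generators of the right ideal kill [v]; then the whole ideal
    does, and acting on [v] descends to the quotient. *)
Lemma Rmod_hom (N : rmod K) (v : N) :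
  v \act H = - (2%:R * a + l%:~R) *: v ->
  v \act E \act F = - ((a + l%:~R) * (a + 1)) *: v ->
  exists h : hom Q N, h Rgen = v.
Proof.
move=> vH vEF; pose g (u : Q) : N := env_act v (repr u).
have gpi u : g (Rpi u) = env_act v u.
  rewrite /g; apply/eqP; rewrite -subr_eq0 -linearB; apply/eqP.
  have /Rpi_eq[b [c ->]] : Rpi (repr (Rpi u)) = Rpi u by apply: reprK.
  rewrite linearD /= 2!env_actM !linearD /= !linearZ /= env_actM.
  rewrite !env_act_gen !env_act1 vH vEF -!scalerDl !addNr !scale0r !env_act0.
  by rewrite addr0.
have gl : linear g.
  move=> c u w; have [u' <-] := Rpi_surj u; have [w' <-] := Rpi_surj w.
  by rewrite -linearP !gpi linearP.
have gact x u : g (u \act x) = g u \act x.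
  have [w <-] := Rpi_surj u.
  by rewrite Rpi_act !gpi env_actM env_act_gen.
by exists (Hom gl gact); rewrite /= gpi env_act1.
Qed.

End Cyclic.

(** * Modules with one-dimensional integral weight spaces *)

(* [wvec n] is a chosen vector of weight n, zero when n is not in [dom]; E maps
   [wvec n] to [ecoef n *: wvec (n - 2)] and F maps it to
   [fcoef n *: wvec (n + 2)].  These scalars vanish on an arrow leaving [dom],
   and are junk at weights outside [dom]. *)
Record ladder (K : fieldType) (N : rmod K) := Ladder {
  dom : pred int;
  wvec : int -> N;
  coord : N -> int -> K;
  ecoef : int -> K;
  fcoef : int -> K;
  coordP : forall a u v n, coord (a *: u + v) n = a * coord u n + coord v n;
  coord_wvec : forall m n, coord (wvec m) n = ((m == n) && dom n)%:R;
  coord_dom : forall v n, ~~ dom n -> coord v n = 0;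
  coord_fin : forall v, exists s : seq int,
    forall n, n \notin s -> coord v n = 0;
  coord_inj0 : forall v, (forall n, coord v n = 0) -> v = 0;
  coord_H : forall v n, coord (v \act H) n = n%:~R * coord v n;
  coord_E : forall v n, coord (v \act E) n = ecoef (n + 2) * coord v (n + 2);
  coord_F : forall v n, coord (v \act F) n = fcoef (n - 2) * coord v (n - 2) }.

Section Ladder.
Variables (K : fieldType) (N : rmod K) (L : ladder N).

Lemma coordB u v n : coord L (u - v) n = coord L u n - coord L v n.
Proof. by rewrite addrC -scaleN1r coordP mulN1r addrC. Qed.

Lemma coord0 n : coord L 0 n = 0.
Proof. by rewrite -(subrr (0 : N)) coordB subrr. Qed.

Lemma coordZ a u n : coord L (a *: u) n = a * coord L u n.
Proof. by rewrite -[a *: u]addr0 coordP coord0 addr0. Qed.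

Lemma coord_inj u v : (forall n, coord L u n = coord L v n) -> u = v.
Proof.
move=> uv; apply/eqP; rewrite -subr_eq0; apply/eqP/(@coord_inj0 _ _ L) => n.
by rewrite coordB uv subrr.
Qed.

Lemma wvec_H n : wvec L n \act H = n%:~R *: wvec L n.
Proof.
apply: coord_inj => m; rewrite coord_H coordZ coord_wvec.
by have [->|_] := eqVneq n m; rewrite //= !mulr0.
Qed.

Lemma coord_comb (s : seq int) (g : int -> K) n : uniq s ->
  coord L (\sum_(m <- s) g m *: wvec L m) n
  = if (n \in s) && dom L n then g n else 0.
Proof.
elim: s => [|m s IHs] /=; first by rewrite big_nil coord0.
case/andP => ms us; rewrite big_cons coordP IHs // coord_wvec inE.
case: (eqVneq m n) => [<-|_]; last by rewrite mulr0 add0r.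
by rewrite (negbTE ms) /= addr0; case: (dom L m); rewrite (mulr1, mulr0).
Qed.

Lemma coord_expand v : exists s : seq int,
  [/\ uniq s, forall n, n \notin s -> coord L v n = 0
    & v = \sum_(m <- s) coord L v m *: wvec L m].
Proof.
have [s hs] := coord_fin L v; exists (undup s); split.
- exact: undup_uniq.
- by move=> n; rewrite mem_undup => /hs.
apply: coord_inj => n; rewrite coord_comb ?undup_uniq // mem_undup.
have [ns|/hs->] := boolP (n \in s); last by [].
by have [|/coord_dom ->] := boolP (dom L n).
Qed.

Lemma coord_realize (s : seq int) (g : int -> K) :
  (forall n, n \notin s -> g n = 0) -> (forall n, ~~ dom L n -> g n = 0) ->
  exists v, forall n, coord L v n = g n.
Proof.
move=> gs gd; exists (\sum_(m <- undup s) g m *: wvec L m) => n.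
rewrite coord_comb ?undup_uniq // mem_undup.
have [ns|/gs->] := boolP (n \in s); last by [].
by have [|/gd ->] := boolP (dom L n).
Qed.

End Ladder.

Lemma inj_surj_bij (T U : Type) (g : T -> U) :
  injective g -> (forall y, exists x, g x = y) -> bijective g.
Proof.
move=> inj /choice[h hK]; exists h => // x; apply: inj; exact: hK.
Qed.

(** * Homomorphisms and exactness in weight coordinates *)

Section Homs.
Variables (K : fieldType) (K0 : injective (fun n : int => n%:~R : K)).

Section Diagonal.
Variables (M N : rmod K) (A : ladder M) (B : ladder N) (f : hom M N).

Definition hdiag n : K := coord B (f (wvec A n)) n.

(** On this coordinate [H] acts both by n and by m, which differ in K by [K0]. *)
Lemma hom_wvec_off m n : m != n -> coord B (f (wvec A m)) n = 0.
Proof.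
move=> mn; apply/eqP.
have: n%:~R * coord B (f (wvec A m)) n = m%:~R * coord B (f (wvec A m)) n.
  by rewrite -coord_H -hom_act wvec_H linearZ coordZ.
move/eqP; rewrite -subr_eq0 -mulrBl mulf_eq0 => /orP[|//].
by rewrite subr_eq0 => /eqP/K0 nm; rewrite nm eqxx in mn.
Qed.

Lemma hom_coord v n : coord B (f v) n = hdiag n * coord A v n.
Proof.
have [s [us s0 sv]] := coord_expand A v; rewrite {1}sv linear_sum /=.
have -> : coord B (\sum_(m <- s) f (coord A v m *: wvec A m)) n
    = \sum_(m <- s) coord A v m * coord B (f (wvec A m)) n.
  elim: (s) => [|m t IHt]; first by rewrite !big_nil coord0.
  by rewrite !big_cons linearZ coordP IHt.
have [ns|ns] := boolP (n \in s); last first.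
  rewrite s0 // mulr0 big_seq big1 // => m ms.
  by rewrite hom_wvec_off ?mulr0 //; apply: contraNneq ns => <-.
rewrite (bigD1_seq n) //= big1 ?addr0 1?mulrC // => m mn.
by rewrite hom_wvec_off ?mulr0.
Qed.

Definition hsupp n := hdiag n != 0.

Lemma hdiag_dom n : ~~ (dom A n && dom B n) -> hdiag n = 0.
Proof.
rewrite negb_and => /orP[nA|nB]; last by rewrite /hdiag coord_dom.
suff -> : hdiag n = 0 * hdiag n by rewrite mul0r.
rewrite /hdiag; have -> : wvec A n = 0; last by rewrite linear0 coord0 mul0r.
by apply: (@coord_inj0 _ _ A) => m; rewrite coord_wvec; case: eqP => // <-;
   rewrite (negbTE nA).
Qed.

Lemma hsupp_dom n : hsupp n -> dom A n /\ dom B n.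
Proof. by move=> h; apply/andP; apply: contraNT h => /hdiag_dom ->. Qed.

(** Compatibility of [f] with [E] on one weight vector. It carries nonvanishing of the diagonal
    entry from n to n - 2 wherever the target coefficient is nonzero. *)
Lemma hdiag_E n : dom A n -> hdiag (n - 2) * ecoef A n = ecoef B n * hdiag n.
Proof.
move=> An; have := coord_E B (f (wvec A n)) (n - 2).
by rewrite -hom_act hom_coord coord_E subrK coord_wvec eqxx An mulr1 => ->.
Qed.

Lemma hdiag_F n : dom A n -> hdiag (n + 2) * fcoef A n = fcoef B n * hdiag n.
Proof.
move=> An; have := coord_F B (f (wvec A n)) (n + 2).
by rewrite -hom_act hom_coord coord_F addrK coord_wvec eqxx An mulr1 => ->.
Qed.

Lemma hom_ker v : f v = 0 <-> forall n, hsupp n -> coord A v n = 0.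
Proof.
split=> [fv n hn|h].
  have := hom_coord v n; rewrite fv coord0 => /esym/eqP.
  by rewrite mulf_eq0 (negbTE hn) => /eqP.
apply: (@coord_inj0 _ _ B) => n; rewrite hom_coord.
by have [/h->|/negPn/eqP->] := boolP (hsupp n); rewrite ?mulr0 ?mul0r.
Qed.

Lemma hom_im u :
  (exists v, f v = u) <-> forall n, ~~ hsupp n -> coord B u n = 0.
Proof.
split=> [[v <-] n /negPn/eqP h|h]; first by rewrite hom_coord h mul0r.
have [s hs] := coord_fin B u.
(* Off the support the quotient is a division by 0, equal to 0, which is right there since [u] has
   no such coordinate. *)
have [||v hv] := @coord_realize _ _ A s (fun n => coord B u n / hdiag n).
- by move=> n /hs ->; rewrite mul0r.
- by move=> n An; rewrite hdiag_dom ?invr0 ?mulr0 // (negbTE An).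
exists v; apply: (@coord_inj _ _ B) => n; rewrite hom_coord hv.
have [hn|hn] := boolP (hsupp n); first by rewrite mulrC divfK.
by rewrite h // mul0r mulr0.
Qed.

Lemma hom_injP : injective f <-> forall n, dom A n -> hsupp n.
Proof.
split=> [inj_f n An|h u v fuv].
  apply: contraT => hn; suff /eqP: wvec A n = 0.
    by have := coord_wvec A n n; rewrite eqxx An => + /eqP z; rewrite z coord0
      => /esym/eqP; rewrite oner_eq0.
  apply: inj_f; rewrite linear0; apply/hom_ker => m hm; rewrite coord_wvec.
  by case: eqP => // nm; rewrite -nm (negbTE hn) in hm.
apply/eqP; rewrite -subr_eq0; apply/eqP.
have /hom_ker fz : f (u - v) = 0 by rewrite linearB /= fuv subrr.
apply: (@coord_inj0 _ _ A) => n.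
by have [/h/fz|/coord_dom ->] := boolP (dom A n).
Qed.

Lemma hom_surjP :
  (forall u, exists v, f v = u) <-> forall n, dom B n -> hsupp n.
Proof.
split=> [sur n Bn|h u].
  apply: contraT => hn; have /hom_im/(_ n hn) := sur (wvec B n).
  by rewrite coord_wvec eqxx Bn => /eqP; rewrite oner_eq0.
by apply/hom_im => n hn; apply: coord_dom; apply: contra hn => /h.
Qed.

Lemma hom_bijP : bijective f <->
  (forall n, dom A n -> hsupp n) /\ (forall n, dom B n -> hsupp n).
Proof.
rewrite -hom_injP -hom_surjP; split=> [[g fK gK]|[inj sur]].
  by split; [exact: can_inj fK | move=> u; exists (g u)].
exact: inj_surj_bij.
Qed.

End Diagonal.

Section Exactness.
Variables (M N P : rmod K) (A : ladder M) (B : ladder N) (C : ladder P).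
Variables (i : hom M N) (p : hom N P).

(** The image of [i] and the kernel of [p] are coordinate subspaces, given by the support of [i] and
    the complement of the support of [p]; testing on each [wvec n] compares them. *)
Lemma short_exactP : short_exact i p <->
  [/\ forall n, dom A n -> hsupp A B i n, forall n, dom C n -> hsupp B C p n
    & forall n, dom B n -> hsupp B C p n = ~~ hsupp A B i n].
Proof.
have off n m : m != n -> coord B (wvec B n) m = 0.
  by rewrite coord_wvec eq_sym => /negbTE ->.
split=> [[/(hom_injP A B) inj ex /(hom_surjP B C) sur]|[inj sur ex]]; split.
- exact: inj.
- exact: sur.
- move=> n Bn; have Bnn : coord B (wvec B n) n != 0.
    by rewrite coord_wvec eqxx Bn oner_eq0.
  apply/idP/idP => [hp|hi].
    apply/negP => hi; case/eqP: Bnn.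
    suff /ex/(hom_ker B C)/(_ n hp) : exists v, i v = wvec B n by [].
    by apply/(hom_im A B) => m hm; apply: off; apply: contraNneq hm => ->.
  apply: contraT => hp; case/eqP: Bnn.
  suff /ex/(hom_im A B)/(_ n hi) : p (wvec B n) = 0 by [].
  by apply/(hom_ker B C) => m hm; apply: off; apply: contraNneq hp => <-.
- exact/(hom_injP A B).
- move=> y; rewrite (hom_ker B C) (hom_im A B).
  split=> h n hn; have [Bn|/coord_dom->//] := boolP (dom B n); apply: h.
    by rewrite ex.
  by rewrite -ex.
- exact/(hom_surjP B C).
Qed.

End Exactness.

Lemma isomorphic_ladder (M N : rmod K) (A : ladder M) (B : ladder N)
  (f : hom M N) : bijective f -> dom A =1 dom B.
Proof.
move=> /(hom_bijP A B)[hA hB] n.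
by apply/idP/idP => [/hA|/hB] /hsupp_dom[].
Qed.

Section SeqIso.
Variables (M N P M' N' P' : rmod K).
Variables (A : ladder M) (B : ladder N) (C : ladder P).
Variables (A' : ladder M') (B' : ladder N') (C' : ladder P').
Variables (i : hom M N) (p : hom N P) (i' : hom M' N') (p' : hom N' P').
Hypotheses (ex : short_exact i p) (ex' : short_exact i' p').
Hypothesis domA : dom A =1 dom A'.

(** Both submodules are spanned by the weight vectors with weight in [dom A], and an isomorphism [b]
    of the middle terms is diagonal with nonzero entries. So [b] maps one submodule onto the other,
    and it induces [a] and [c]. *)
Lemma seq_isomorphic_of_ladder : isomorphic N N' -> seq_isomorphic i p i' p'.
Proof.
move=> [b bij_b]; have [inj_i ex_ip sur_p] := ex.
have [inj_i' ex_ip' sur_p'] := ex'.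
have [/(_ _)hA _ _] := (short_exactP A B C i p).1 ex.
have [/(_ _)hA' _ _] := (short_exactP A' B' C' i' p').1 ex'.
have supp_ii' n : hsupp A B i n = hsupp A' B' i' n.
  by apply/idP/idP => [/hsupp_dom[]|/hsupp_dom[]] An _;
     [apply: hA'; rewrite -domA | apply: hA; rewrite domA].
have [bN bN'] := (hom_bijP B B' b).1 bij_b.
have imE y : (exists x, i x = y) <-> (exists x, i' x = b y).
  rewrite (hom_im A B) (hom_im A' B').
  split=> h n hn; have := h n; rewrite (hom_coord B B').
    by rewrite supp_ii' => ->; rewrite ?mulr0.
  rewrite -supp_ii' => /(_ hn)/eqP; rewrite mulf_eq0 => /orP[h0|/eqP//].
  by apply: coord_dom; apply: contraTN h0 => /bN.
have /choice[a aE] : forall x, exists x', i' x' = b (i x).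
  by move=> x; apply/imE; exists x.
have alin : linear a.
  by move=> c u v; apply: inj_i'; rewrite [RHS]linearP /= !aE !linearP.
have aact x v : a (v \act x) = a v \act x.
  by apply: inj_i'; rewrite hom_act !aE !hom_act.
(* [c] is defined through a set-theoretic section of [p]; it does not depend on the section because
   [b] respects the images, hence the kernels. *)
have [s sK] := choice sur_p.
pose c z := p' (b (s z)).
have cE y : c (p y) = p' (b y).
  apply/eqP; rewrite /c -subr_eq0 -!linearB; apply/eqP/ex_ip'/imE/ex_ip.
  by rewrite linearB /= sK subrr.
have clin : linear c.
  by move=> k u v; rewrite -(sK u) -(sK v) -linearP !cE !linearP.
have cact x v : c (v \act x) = c v \act x.
  by rewrite -(sK v) -hom_act !cE !hom_act.
exists (Hom alin aact), b, (Hom clin cact); split.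
- apply: inj_surj_bij => [x y axy|x].
    apply/inj_i/(bij_inj bij_b); by rewrite -!aE; congr (i' _).
  have [g gK bK] := bij_b; have /imE[y yx] : exists x', i' x' = b (g (i' x)).
    by exists x; rewrite bK.
  by exists y; apply: inj_i'; rewrite /= aE yx bK.
- exact: bij_b.
- apply: inj_surj_bij => [u v|z].
    rewrite -(sK u) -(sK v) /= !cE => /eqP; rewrite -subr_eq0 -!linearB.
    move=> /eqP/ex_ip'/imE/ex_ip/eqP; rewrite linearB subr_eq0.
    by move=> /eqP.
  have [y <-] := sur_p' z; have [g gK bK] := bij_b.
  by exists (p (g y)); rewrite /= cE bK.
- by move=> x; rewrite /= aE.
- exact: cE.
Qed.

End SeqIso.

End Homs.

(** * Formal properties of isomorphisms and of the twist *)

Section IsoBasics.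
Variables (K : fieldType).

Lemma isomorphic_sym (M N : rmod K) : isomorphic M N -> isomorphic N M.
Proof.
move=> [f [g fK gK]]; have inj := can_inj fK.
have glin : linear g by move=> a u v; apply: inj; rewrite [RHS]linearP /= !gK.
have gact x v : g (v \act x) = g v \act x by apply: inj; rewrite hom_act !gK.
by exists (Hom glin gact); exists f.
Qed.

Lemma isomorphic_trans (M N P : rmod K) :
  isomorphic M N -> isomorphic N P -> isomorphic M P.
Proof.
move=> [f bf] [g bg].
have lin : linear (g \o f) by move=> a u v; rewrite /= !linearP.
have act x v : (g \o f) (v \act x) = (g \o f) v \act x by rewrite /= !hom_act.
by exists (Hom lin act); apply: bij_comp.
Qed.

Lemma twist_short_exact (M N P : rmod K) (i : hom M N) (p : hom N P) :
  short_exact i p -> short_exact (twist_hom i) (twist_hom p).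
Proof. by []. Qed.

(** The twist is an involution only up to the equation - - v = v, so moving it from the target of a
    map to its source takes a proof. *)
Lemma untwist_hom_act (M N : rmod K) (f : hom M (twist N)) x (v : twist M) :
  @act K N x (f v) = f (v \act x).
Proof.
case: x; [exact: (esym (hom_act f F v)) | exact: (esym (hom_act f E v)) |].
change (@act K N H (f v) = f (- @act K M H v)); rewrite linearN.
by apply/esym/(etrans (congr1 -%R (hom_act f H v))); exact: opprK.
Qed.

Definition untwist_hom (M N : rmod K) (f : hom M (twist N)) : hom (twist M) N :=
  @Hom K (twist M) N f (hom_linear f)
    (fun x v => esym (@untwist_hom_act M N f x v)).

End IsoBasics.

(** * Weight coordinates of twists and duals *)

Section LadderConstructions.
Variables (K : fieldType) (K0 : injective (fun n : int => n%:~R : K)).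

Section Coefficients.
Variables (N : rmod K) (L : ladder N).

Lemma ecoef_bound n : dom L n -> ~~ dom L (n - 2) -> ecoef L n = 0.
Proof.
move=> Ln Ln2; have := coord_E L (wvec L n) (n - 2).
by rewrite coord_dom // subrK coord_wvec eqxx Ln mulr1 => <-.
Qed.

Lemma fcoef_bound n : dom L n -> ~~ dom L (n + 2) -> fcoef L n = 0.
Proof.
move=> Ln Ln2; have := coord_F L (wvec L n) (n + 2).
by rewrite coord_dom // addrK coord_wvec eqxx Ln mulr1 => <-.
Qed.

Lemma wvec_dom n : ~~ dom L n -> wvec L n = 0.
Proof.
move=> Ln; apply: (@coord_inj0 _ _ L) => m; rewrite coord_wvec.
by case: eqP => //= <-; rewrite (negbTE Ln).
Qed.

Lemma wvec_E n : dom L n -> wvec L n \act E = ecoef L n *: wvec L (n - 2).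
Proof.
move=> Ln; apply: (@coord_inj _ _ L) => m; rewrite coord_E coordZ !coord_wvec.
case: (eqVneq n (m + 2)) => [n_eq|/negP nm]; last first.
  by rewrite (_ : (n - 2 == m) = false) ?mulr0 //; lia.
have -> : n - 2 = m by lia.
rewrite -n_eq Ln eqxx /=; have [//|Lm] := boolP (dom L m).
by rewrite ecoef_bound ?mul0r // n_eq addrK.
Qed.

Lemma wvec_F n : dom L n -> wvec L n \act F = fcoef L n *: wvec L (n + 2).
Proof.
move=> Ln; apply: (@coord_inj _ _ L) => m; rewrite coord_F coordZ !coord_wvec.
case: (eqVneq n (m - 2)) => [n_eq|/negP nm]; last first.
  by rewrite (_ : (n + 2 == m) = false) ?mulr0 //; lia.
have -> : n + 2 = m by lia.
rewrite -n_eq Ln eqxx /=; have [//|Lm] := boolP (dom L m).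
by rewrite fcoef_bound ?mul0r // n_eq subrK.
Qed.

(** The relation [E,F] = H read on the weight space n. *)
Lemma coef_comm n : dom L n ->
  ecoef L n * fcoef L (n - 2) - fcoef L n * ecoef L (n + 2) = n%:~R.
Proof.
move=> Ln; have := congr1 (coord L ^~ n) (act_EF (wvec L n)).
rewrite /= coordB (coord_F _ (wvec L n \act E)) (coord_E _ (wvec L n \act F)).
rewrite coord_E coord_F coord_H subrK addrK coord_wvec eqxx Ln !mulr1 => <-.
by congr (_ - _); rewrite mulrC.
Qed.

End Coefficients.

Definition twist_ladder (N : rmod K) (L : ladder N) : ladder (twist N).
Proof.
apply: (@Ladder K (twist N) (fun n => dom L (- n)) (fun n => wvec L (- n))
  (fun v n => coord L v (- n)) (fun n => fcoef L (- n))
  (fun n => ecoef L (- n))).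
- by move=> a u v n; rewrite -coordP.
- by move=> m n; rewrite coord_wvec eqr_opp.
- by move=> v n; apply: coord_dom.
- move=> v; have [s hs] := coord_fin L v; exists (map -%R s) => n ns.
  by apply: hs; apply: contra ns => /(map_f -%R); rewrite opprK.
- by move=> v h; apply: (@coord_inj0 _ _ L) => n; rewrite -[n]opprK.
- move=> v n; rewrite [v \act H]/= -scaleN1r coordZ coord_H mulN1r.
  by rewrite rmorphN mulNr opprK.
- move=> v n; rewrite [v \act E]/= coord_F.
  by have -> : - (n + 2) = - n - 2 by lia.
- move=> v n; rewrite [v \act F]/= coord_E.
  by have -> : - (n - 2) = - n + 2 by lia.
Defined.

(** The coordinate forms will be the dual basis; each one vanishes on all weight spaces but one. *)
Lemma coord_form_subproof (N : rmod K) (L : ladder N) n :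
  restricted_form (fun v : N => coord L v n : K^o).
Proof.
apply/asboolP; split; first by move=> a u v; apply: coordP.
exists [:: n%:~R] => nu v wv; rewrite inE => nun.
have := coord_H L v n; rewrite wv coordZ => /eqP.
by rewrite -subr_eq0 -mulrBl mulf_eq0 subr_eq0 (negbTE nun) => /eqP.
Qed.

(** The finiteness condition on a restricted form lists weights in K, while a ladder asks for
    integers; scalars that are not integers are dropped. *)
Lemma seq_int_cover (s : seq K) :
  exists t : seq int, forall n : int, n \notin t -> n%:~R \notin s.
Proof.
elim: s => [|x s [t ht]]; first by exists [::].
have [[m mx]|nx] := pselect (exists m : int, m%:~R = x).
  exists (m :: t) => n; rewrite !inE !negb_or => /andP[nm /ht ->].
  by rewrite -mx andbT; apply: contra nm => /eqP/K0 ->.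
exists t => n nt; rewrite inE negb_or ht // andbT.
by apply/eqP => nx'; apply: nx; exists n.
Qed.

Lemma dual_form0 (N : rmod K) (phi : dual_space N) : phi 0 = 0.
Proof. by rewrite -(scale0r 0) dual_formZ mul0r. Qed.

(** Transposition through [tau] makes [E] from n to n - 2 the transpose of [F] from n - 2 to n, and
    conversely. The tests on [dom L] replace junk coefficients of [L] by the 0 required on an arrow
    leaving the domain. *)
Definition dual_ladder (N : rmod K) (L : ladder N) : ladder (dual N).
Proof.
apply: (@Ladder K (dual N) (dom L)
  (fun n => DualSpace (@coord_form_subproof N L n))
  (fun (phi : dual_space N) n => phi (wvec L n) : K)
  (fun n => if dom L (n - 2) then fcoef L (n - 2) else 0)
  (fun n => if dom L (n + 2) then ecoef L (n + 2) else 0)).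
- by [].
- by move=> m n; rewrite /= coord_wvec eq_sym; case: eqP => // ->.
- by move=> phi n Ln; rewrite wvec_dom // dual_form0.
- move=> phi; have /asboolP[_ [s hs]] := dual_formP phi.
  have [t ht] := seq_int_cover s.
  by exists t => n /ht ns; apply: (hs _ _ _ ns); apply: wvec_H.
- move=> phi h; apply/val_inj/funext => v /=.
  have /asboolP[lphi _] := dual_formP phi.
  have [s [_ _ ->]] := coord_expand L v.
  elim: s => [|n s IHs]; first by rewrite big_nil dual_form0.
  by rewrite big_cons lphi h IHs addr0 /GRing.scale /= mulr0.
- by move=> phi n; rewrite /= wvec_H dual_formZ.
- move=> phi n; rewrite /= addrK.
  have [Ln|/wvec_dom->] := boolP (dom L n); last first.
    by rewrite linear0 dual_form0 mul0r.
  by rewrite wvec_F // dual_formZ.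
- move=> phi n; rewrite /= subrK.
  have [Ln|/wvec_dom->] := boolP (dom L n); last first.
    by rewrite linear0 dual_form0 mul0r.
  by rewrite wvec_E // dual_formZ.
Defined.

(** A map and its transpose have the same diagonal entries, so the two supports merely trade
    places. *)
Lemma dual_short_exact (M N P : rmod K) (A : ladder M) (B : ladder N)
    (C : ladder P) (i : hom M N) (p : hom N P) :
  short_exact i p -> short_exact (dual_hom p) (dual_hom i).
Proof.
move=> /(short_exactP K0 A B C)[hi hp ex].
apply/(short_exactP K0 (dual_ladder C) (dual_ladder B) (dual_ladder A)).
split=> [n|n|n Bn]; [exact: (hp n) | exact: (hi n)|].
by have := ex n Bn; rewrite -[hsupp _ _ (dual_hom i) n]/(hsupp A B i n)
  -[hsupp _ _ (dual_hom p) n]/(hsupp B C p n) => ->; rewrite negbK.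
Qed.

End LadderConstructions.

(** * Universal property of Verma modules *)

Section ActionIdentities.
Variables (K : fieldType) (N : rmod K).
Implicit Type v : N.

Lemma actD x u v : (u + v) \act x = u \act x + v \act x.
Proof. exact: linearD. Qed.

Lemma actZ x a v : (a *: v) \act x = a *: (v \act x).
Proof. exact: linearZ. Qed.

Lemma act_FE v : v \act F \act E = v \act E \act F - v \act H.
Proof. by rewrite -act_EF opprB addrC subrK. Qed.

Lemma act_FH v : v \act F \act H = v \act H \act F + 2%:R *: (v \act F).
Proof. by rewrite -[2%:R *: _]opprK -act_HF opprB addrC subrK. Qed.

Lemma act_EH v : v \act E \act H = v \act H \act E - 2%:R *: (v \act E).
Proof. by rewrite -act_HE opprB addrC subrK. Qed.

End ActionIdentities.

Section VermaHom.
Variables (K : fieldType) (mu : K) (N : rmod K) (v : N).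
Hypotheses (vE : v \act E = 0) (vH : v \act H = - mu *: v).

Definition verma_map (p : {poly K}) : N :=
  \sum_(k < size p) p`_k *: iter k (act F) v.

Lemma verma_mapEw n (p : {poly K}) : (size p <= n)%N ->
  verma_map p = \sum_(k < n) p`_k *: iter k (act F) v.
Proof.
move=> pn.
rewrite [LHS](big_ord_widen n (fun k => p`_k *: iter k (act F) v)) //.
rewrite [LHS]big_mkcond; apply: eq_bigr => k _; case: ltnP => // kp.
by rewrite nth_default ?scale0r.
Qed.

Lemma verma_map_linear : linear verma_map.
Proof.
move=> a p q; pose n := maxn (size p) (maxn (size q) (size (a *: p + q))).
rewrite !(@verma_mapEw n) ?leq_max ?leqnn ?orbT //.
rewrite scaler_sumr -big_split /=; apply: eq_bigr => k _.
by rewrite coefD coefZ scalerDl scalerA.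
Qed.

HB.instance Definition _ :=
  GRing.isLinear.Build K {poly K} N _ verma_map verma_map_linear.

Lemma verma_map_cons p c :
  verma_map (p * 'X + c%:P) = verma_map p \act F + c *: v.
Proof.
rewrite (@verma_mapEw (size p).+1) ?size_MXaddC; last by case: ifP.
rewrite big_ord_recl /= addrC; congr (_ + _); last first.
  by rewrite coefD coefMX coefC add0r.
rewrite /verma_map linear_sum; apply: eq_bigr => k _.
by rewrite linearZ /= coefD coefMX coefC addr0.
Qed.

(** Only [F] is immediate. [H], and then [E], follow by induction on p = q.F + c.1, moving the
    operator past [F] by the same commutation relation on both sides; the case of [E] uses that of
    [H]. *)
Lemma verma_map_act x (p : verma mu) :
  verma_map (p \act x) = verma_map p \act x.
Proof.
have mapF (q : verma mu) : verma_map (q \act F) = verma_map q \act F.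
  have := verma_map_cons q 0; rewrite scale0r polyC0 !addr0 => <-.
  by rewrite /= mulrC.
have map1 : verma_map 1 = v.
  by rewrite /verma_map size_poly1 big_ord1 coef1 scale1r.
have mapZ a q : verma_map (a *: q) = a *: verma_map q by apply: linearZ.
have mapD q r : verma_map (q + r) = verma_map q + verma_map r by apply: linearD.
have consE (q : {poly K}) c :
    q * 'X + c%:P = ((q : verma mu) \act F) + c *: (1 : verma mu).
  by rewrite /= mulrC alg_polyC.
have mapH (q : verma mu) : verma_map (q \act H) = verma_map q \act H.
  elim/poly_ind: q => [|q c IHq]; first by rewrite !linear0.
  rewrite consE actD actZ (act_FH (q : verma mu)) (verma_H1 mu).
  by rewrite !mapD !mapZ !mapF map1 IHq actD actZ act_FH vH.
have mapE (q : verma mu) : verma_map (q \act E) = verma_map q \act E.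
  elim/poly_ind: q => [|q c IHq]; first by rewrite !linear0.
  rewrite consE actD actZ (act_FE (q : verma mu)) (verma_E1 mu).
  rewrite scaler0 addr0 [LHS]linearB /= mapF mapH IHq.
  by rewrite mapD mapZ map1 mapF actD actZ vE scaler0 addr0 act_FE.
by case: x.
Qed.

Lemma verma_hom : exists h : hom (verma mu) N, h 1 = v.
Proof.
exists (@Hom K (verma mu) N verma_map verma_map_linear verma_map_act).
by rewrite /= /verma_map size_poly1 big_ord1 coef1 scale1r.
Qed.

End VermaHom.

(** * Casimir scalar and weight coordinates of Verma modules *)

(** Inverse of k -> 2k - mu, the weight of ['X^k] in M(mu). *)
Definition verma_idx (mu n : int) : option nat :=
  if n + mu is Posz m then if odd m then None else Some m./2 else None.

Lemma verma_idxE mu n k : verma_idx mu n = Some k <-> n = k.*2%:Z - mu.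
Proof.
rewrite /verma_idx; split=> [|->].
  by case nm: (n + mu) => [m|//]; case: ifP => // om [<-]; lia.
by rewrite subrK odd_double doubleK.
Qed.

Lemma verma_idxP mu n :
  (forall k : nat, n <> k.*2%:Z - mu) -> verma_idx mu n = None.
Proof. by case e: (verma_idx mu n) => [k|] // /(_ k); case/verma_idxE: e. Qed.

Section Casimir.
Variables (K : fieldType) (K0 : injective (fun n : int => n%:~R : K)).

Lemma intr_neq0 (n : int) : n != 0 -> n%:~R != 0 :> K.
Proof. by apply: contraNneq => n0; apply/eqP/K0; rewrite n0. Qed.

(** On weight n the Casimir element is 2EF - n + n^2/2; setting it equal to l(l-2)/2 and solving for
    EF gives this scalar. *)
Definition kappa (l n : int) : K := - ((n - l)%:~R * (n + l - 2)%:~R) / 4%:R.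

Let four_neq0 : 4%:R != 0 :> K.
Proof. exact: (@intr_neq0 4). Qed.

Lemma kappaD2 l n : kappa l (n + 2) = kappa l n - n%:~R.
Proof. by rewrite /kappa !(rmorphD, rmorphN) /=; field. Qed.

Lemma kappaB2 l n : kappa l (n - 2) = kappa l n + (n - 2)%:~R.
Proof. by rewrite /kappa !(rmorphD, rmorphN) /=; field. Qed.

Lemma kappa_eq0 l n : (kappa l n == 0) = (n == l) || (n == 2 - l).
Proof.
rewrite /kappa mulf_eq0 invr_eq0 (negbTE four_neq0) orbF oppr_eq0 mulf_eq0.
have z m : (m%:~R == 0 :> K) = (m == 0).
  by apply/idP/idP => [|/eqP->//]; apply: contraTT => /intr_neq0.
by rewrite !z; lia.
Qed.

(** The scalar is symmetric about weight 1, the midpoint of its roots. This expresses the invariance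
    of the Casimir element under the twist. *)
Lemma kappa_opp l n : kappa l (- n) = kappa l (n + 2).
Proof. by rewrite /kappa !(rmorphD, rmorphN) /=; field. Qed.

Definition casimir (l : int) (N : rmod K) (L : ladder N) : Prop :=
  forall n, dom L n -> ecoef L n * fcoef L (n - 2) = kappa l n.

Lemma casimir_F l (N : rmod K) (L : ladder N) : casimir l L ->
  forall n, dom L n -> fcoef L n * ecoef L (n + 2) = kappa l (n + 2).
Proof.
move=> cL n Ln; rewrite kappaD2 -(cL n Ln) -(coef_comm Ln).
by rewrite opprB [RHS]addrC subrK.
Qed.

Lemma casimir_twist l (N : rmod K) (L : ladder N) :
  casimir l L -> casimir l (twist_ladder L).
Proof.
move=> cL n Ln; rewrite /= (_ : - (n - 2) = - n + 2); last by lia.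
by rewrite (casimir_F cL) // -kappa_opp; congr (kappa _ _); lia.
Qed.

Lemma casimir_dual l (N : rmod K) (L : ladder N) :
  casimir l L -> casimir l (dual_ladder K0 L).
Proof.
move=> cL n Ln; rewrite /= subrK -(cL n Ln) [dom L n]Ln mulrC.
by case: ifP => // /negbT Ln2; rewrite (@ecoef_bound _ _ L n) // !mul0r.
Qed.

Definition verma_coord (mu : int) (p : {poly K}) (n : int) : K :=
  if verma_idx mu n is Some k then p`_k else 0.

Lemma verma_coordE mu p k : verma_coord mu p (k.*2%:Z - mu) = p`_k.
Proof.
rewrite /verma_coord.
by have /verma_idxE -> : k.*2%:Z - mu = k.*2%:Z - mu by [].
Qed.

(** At n = 2k - mu the [E] coefficient is k(mu - k + 1), written in terms of n. *)
Definition verma_ladder (mu : int) : ladder (verma (mu%:~R : K)).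
Proof.
apply: (@Ladder K (verma (mu%:~R : K)) (fun n => verma_idx mu n)
  (fun n => if verma_idx mu n is Some k then 'X^k else 0)
  (verma_coord mu)
  (fun n => (n + mu)%:~R * (mu - n + 2)%:~R / 4%:R) (fun n => 1)).
- move=> a u v n; rewrite /verma_coord; case: verma_idx => [k|].
    by rewrite coefD coefZ.
  by rewrite mulr0 addr0.
- move=> m n; rewrite /verma_coord.
  case en: (verma_idx mu n) => [k|]; last by rewrite andbF.
  rewrite andbT; case em: (verma_idx mu m) => [j|].
    rewrite coefXn; congr (_ : bool)%:R.
    by move/verma_idxE: en; move/verma_idxE: em; lia.
  by rewrite coef0; case: eqP => // mn; rewrite mn en in em.
- by move=> v n; rewrite /verma_coord; case: verma_idx.
- move=> p; exists [seq k.*2%:Z - mu | k <- iota 0 (size p)] => n nk.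
  rewrite /verma_coord; case en: verma_idx => [k|//].
  rewrite nth_default // leqNgt; apply: contra nk => kp.
  by apply/mapP; exists k; [rewrite mem_iota | apply/verma_idxE].
- by move=> p h; apply/polyP => k; rewrite -(verma_coordE mu) h coef0.
- move=> p n; rewrite /verma_coord; case en: verma_idx => [k|]; last first.
    by rewrite mulr0.
  move/verma_idxE: en => ->; rewrite /= coefB !coefZ coefXM coef_deriv.
  rewrite rmorphB /= -[k.*2%:~R]pmulrn -mul2n.
  case: k => [|k] /=; first by ring.
  by rewrite -mulr_natr natrM; ring.
- move=> p n; case: (pselect (exists k : nat, n = k.*2%:Z - mu)) => [[k ->]|nk].
    have -> : k.*2%:Z - mu + 2 = (k.+1).*2%:Z - mu by lia.
    rewrite !verma_coordE /= coefB coefZ coefXM !coef_deriv.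
    have -> : (if k == 0 then 0 else p`_k.-1.+2 *+ k.-1.+2 *+ k.-1.+1)
        = k%:R * (k.+1%:R * p`_k.+1) :> K.
      by case: k => [|k] /=; rewrite ?mul0r // !mulr_natl.
    have -> : p`_k.+1 *+ k.+1 = k.+1%:R * p`_k.+1 by rewrite mulr_natl.
    have k2 : (k.+1).*2%:~R = 2%:R * k.+1%:R :> K by rewrite -mul2n -natrM.
    rewrite subrK !(rmorphD, rmorphN) /= k2 -natr1.
    by move: k%:R p`_k.+1 => x y; field.
  rewrite [LHS]/verma_coord verma_idxP => [|k nE]; last by apply: nk; exists k.
  rewrite /verma_coord; case en: verma_idx => [k|]; last by rewrite mulr0.
  (* Only n + 2 = -mu remains, the lowest weight, where the coefficient vanishes. *)
  move/verma_idxE: en => nE; case: k nE => [|k] nE; last first.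
    by case: nk; exists k; lia.
  by rewrite (_ : n + 2 + mu = 0) ?mul0r //; lia.
- move=> p n; rewrite mul1r.
  case: (pselect (exists k : nat, n = k.*2%:Z - mu)) => [[k ->]|nk].
    rewrite verma_coordE [LHS]coefXM; case: k => [|k].
      by rewrite /verma_coord verma_idxP //; lia.
    have -> : (k.+1).*2%:Z - mu - 2 = k.*2%:Z - mu by lia.
    by rewrite verma_coordE.
  rewrite [LHS]/verma_coord verma_idxP => [|k nE]; last by apply: nk; exists k.
  by rewrite /verma_coord verma_idxP // => k nE; apply: nk; exists k.+1; lia.
Defined.

Lemma dom_verma mu n :
  dom (verma_ladder mu) n = (- mu <= n) && ~~ odd `|n + mu|.
Proof.
have -> : (- mu <= n) = (0 <= n + mu) by rewrite -subr_ge0 opprK.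
by rewrite /= /verma_idx; case: (n + mu) => [m|m] //=; case: odd.
Qed.

(** These are the two roots of mu(mu+2) = l(l-2), the values of mu for which the Casimir scalar of
    M(mu) is the one attached to l. *)
Lemma casimir_verma l mu :
  mu = - l \/ mu = l - 2 -> casimir l (verma_ladder mu).
Proof.
move=> h n _; rewrite /= mulr1 /kappa; case: h => ->;
  by rewrite !(rmorphD, rmorphN) /=; field.
Qed.

End Casimir.

(** * Explicit model for R(l,a) *)

Section DenseModel.
Variables (K : fieldType) (K0 : injective (fun n : int => n%:~R : K)).
Variables (l a : int).

(* The weight of the generator of R(l, a). *)
Definition wgen : int := - (2 * a + l).

(** The basis to be modelled is gen.E^k below the generator and gen.F^k above it: the arrow pointing
    away from the generator is 1, and the returning one must carry the whole product [kappa]. *)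
Definition dense_e n : K := if n <= wgen then 1 else kappa K l n.
Definition dense_f n : K := if n + 2 <= wgen then kappa K l (n + 2) else 1.

Lemma dense_ef n : dense_e n * dense_f (n - 2) = kappa K l n.
Proof.
by rewrite /dense_e /dense_f subrK; case: ifP; rewrite ?mul1r ?mulr1.
Qed.

Lemma dense_fe n : dense_f n * dense_e (n + 2) = kappa K l (n + 2).
Proof. by rewrite -{1}[n](addrK 2) mulrC dense_ef. Qed.

(* All functions on the weights, rather than finitely supported ones: this
   module only has to receive a map from R(l, a). *)
Definition dense_act (x : sl2) (phi : int -> K^o) : int -> K^o :=
  match x with
  | E => fun n => dense_e (n + 2) * phi (n + 2)
  | F => fun n => dense_f (n - 2) * phi (n - 2)
  | H => fun n => n%:~R * phi n
  end.

Lemma dense_act_linear x : linear (dense_act x).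
Proof.
case: x => c u v; apply/funext => n /=; rewrite !fctE /= mulrDr;
  by congr (_ + _); rewrite /GRing.scale /= mulrCA.
Qed.

Lemma dense_EF u :
  dense_act F (dense_act E u) - dense_act E (dense_act F u) = dense_act H u.
Proof.
apply/funext => n; rewrite !fctE /= subrK addrK !mulrA.
rewrite [dense_f _ * _]mulrC dense_ef [dense_e _ * _]mulrC dense_fe -mulrBl.
by rewrite (kappaD2 K0) opprB addrC subrK.
Qed.

Lemma dense_HE u :
  dense_act E (dense_act H u) - dense_act H (dense_act E u)
  = 2%:R *: dense_act E u.
Proof.
apply/funext => n; rewrite !fctE /= rmorphD /= /GRing.scale /=; ring.
Qed.

Lemma dense_HF u :
  dense_act F (dense_act H u) - dense_act H (dense_act F u)
  = - (2%:R *: dense_act F u).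
Proof.
apply/funext => n; rewrite !fctE /= rmorphB /= /GRing.scale /=; ring.
Qed.

Definition dense : rmod K :=
  RMod dense_act_linear dense_EF dense_HE dense_HF.

Definition delta m : dense := fun n => (m == n)%:R.

Lemma delta_E m : delta m \act E = dense_e m *: delta (m - 2).
Proof.
apply/funext => n; rewrite /= !fctE /= /delta /GRing.scale /=.
have -> : (m == n + 2) = (m - 2 == n) by lia.
by case: eqP => [<-|_]; rewrite ?mulr0 ?subrK.
Qed.

Lemma delta_F m : delta m \act F = dense_f m *: delta (m + 2).
Proof.
apply/funext => n; rewrite /= !fctE /= /delta /GRing.scale /=.
have -> : (m == n - 2) = (m + 2 == n) by lia.
by case: eqP => [<-|_]; rewrite ?mulr0 ?addrK.
Qed.

Lemma delta_H m : delta m \act H = m%:~R *: delta m.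
Proof.
apply/funext => n; rewrite /= !fctE /= /delta /GRing.scale /=.
by case: eqP => [<-|_]; rewrite ?mulr0.
Qed.

Lemma wgen_intr : wgen%:~R = - (2%:R * a%:~R + l%:~R) :> K.
Proof. by rewrite /wgen rmorphN rmorphD rmorphM. Qed.

Lemma kappa_wgen : kappa K l wgen = - ((a%:~R + l%:~R) * (a%:~R + 1)).
Proof.
have n4 : 4%:R != 0 :> K by apply: (@intr_neq0 K K0 4).
by rewrite /kappa /wgen !(rmorphD, rmorphN, rmorphM) /=; field.
Qed.

Local Notation Q := (Rmod l (a%:~R : K)).
Local Notation gen := (Rgen l (a%:~R : K)).

(** It sends the vectors gen.E^k and gen.F^k to distinct [delta]'s, so none of them vanishes; its
    values later serve as coordinates. *)
Lemma Rmod_dense_hom : exists h : hom Q dense, h gen = delta wgen.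
Proof.
apply: Rmod_hom; first by rewrite -wgen_intr delta_H.
by rewrite -kappa_wgen delta_E actZ delta_F scalerA subrK dense_ef.
Qed.

End DenseModel.

(** * Weight basis of R(l,a) *)

Section Strings.
Variables (K : fieldType) (K0 : injective (fun n : int => n%:~R : K)).
Variables (l : int) (N : rmod K).

Definition kappa_vec (m : int) (u : N) : Prop :=
  u \act H = m%:~R *: u /\ u \act E \act F = kappa K l m *: u.

Lemma kappa_vec_FE m u :
  kappa_vec m u -> u \act F \act E = kappa K l (m + 2) *: u.
Proof. by case=> uH uEF; rewrite act_FE uEF uH -scalerBl (kappaD2 K0). Qed.

Lemma kappa_vec_F m u : kappa_vec m u -> kappa_vec (m + 2) (u \act F).
Proof.
move=> um; have [uH _] := um; split; last by rewrite (kappa_vec_FE um) actZ.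
by rewrite act_FH uH actZ -scalerDl rmorphD.
Qed.

Lemma kappa_vec_E m u : kappa_vec m u -> kappa_vec (m - 2) (u \act E).
Proof.
move=> [uH uEF]; have uEH : u \act E \act H = (m - 2)%:~R *: (u \act E).
  by rewrite act_EH uH actZ -scalerBl rmorphB.
split=> //; have := act_EF (u \act E); rewrite uEF uEH actZ => /eqP.
by rewrite subr_eq -scalerDl => /eqP->; rewrite (kappaB2 K0) addrC.
Qed.

Lemma kappa_vec_iterF m u k : kappa_vec m u ->
  kappa_vec (m + k.*2%:Z) (iter k (act F) u).
Proof.
move=> um; elim: k => [|k IHk]; first by rewrite addr0.
by have := kappa_vec_F IHk; rewrite (_ : m + _ + 2 = m + k.+1.*2%:Z); last lia.
Qed.

Lemma kappa_vec_iterE m u k : kappa_vec m u ->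
  kappa_vec (m - k.*2%:Z) (iter k (act E) u).
Proof.
move=> um; elim: k => [|k IHk]; first by rewrite subr0.
by have := kappa_vec_E IHk; rewrite (_ : m - _ - 2 = m - k.+1.*2%:Z); last lia.
Qed.

End Strings.

Section CyclicLadder.
Variables (K : fieldType) (K0 : injective (fun n : int => n%:~R : K)).
Variables (l a : int) (Q : rmod K) (gen : Q).
Local Notation w0 := (wgen l a).
Local Notation de := (dense_e K l a).
Local Notation df := (dense_f K l a).

Hypothesis gen_kappa_vec : kappa_vec l w0 gen.

Definition cyc_wvec (n : int) : Q :=
  if odd `|n - l| then 0
  else if n <= w0 then iter (`|n - w0|./2) (act E) gen
  else iter (`|n - w0|./2) (act F) gen.

Lemma cyc_wvec_down k : cyc_wvec (w0 - k.*2%:Z) = iter k (act E) gen.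
Proof.
rewrite /cyc_wvec ifF; last by rewrite /wgen; lia.
by rewrite ifT; [congr (iter _ _ _); lia | lia].
Qed.

Lemma cyc_wvec_up k : cyc_wvec (w0 + k.*2%:Z) = iter k (act F) gen.
Proof.
case: k => [|k]; first by rewrite addr0 -[wgen l a](subr0) (cyc_wvec_down 0).
rewrite /cyc_wvec ifF; last by rewrite /wgen; lia.
by rewrite ifF; [congr (iter _ _ _); lia | lia].
Qed.

(** The successor in [WeightUp] leaves the weight of the generator to [WeightDown] alone. *)
Variant weight_spec (n : int) : Prop :=
| WeightOdd of odd `|n - l| | WeightDown k of n = w0 - k.*2%:Z
| WeightUp k of n = w0 + k.+1.*2%:Z.

Lemma weightP n : weight_spec n.
Proof.
have [on|on] := boolP (odd `|n - l|); first exact: WeightOdd.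
have [nw|nw] := leP n w0.
  by apply: (@WeightDown n (`|n - w0|./2)); move: on nw; rewrite /wgen; lia.
by apply: (@WeightUp n (`|n - w0|./2).-1); move: on nw; rewrite /wgen; lia.
Qed.

Lemma cyc_wvec_odd n : odd `|n - l| -> cyc_wvec n = 0.
Proof. by rewrite /cyc_wvec => ->. Qed.

(** At or below the generator this is the definition; above it, [E] undoes the last [F] up to the
    Casimir scalar. *)
Lemma cyc_wvec_E n : cyc_wvec n \act E = de n *: cyc_wvec (n - 2).
Proof.
case: (weightP n) => [on|k ->|k ->].
- by rewrite !cyc_wvec_odd ?linear0 ?scaler0 //; lia.
- rewrite (_ : _ - 2 = w0 - k.+1.*2%:Z); last by lia.
  by rewrite !cyc_wvec_down /dense_e ifT ?scale1r //; lia.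
rewrite (_ : _ - 2 = w0 + k.*2%:Z); last by lia.
rewrite !cyc_wvec_up iterS.
rewrite (kappa_vec_FE K0 (kappa_vec_iterF K0 k gen_kappa_vec)).
by rewrite /dense_e ifF; [congr (kappa K l _ *: _); lia | lia].
Qed.

Lemma cyc_wvec_F n : cyc_wvec n \act F = df n *: cyc_wvec (n + 2).
Proof.
case: (weightP n) => [on|[|k] ->|k ->].
- by rewrite !cyc_wvec_odd ?linear0 ?scaler0 //; lia.
- rewrite (cyc_wvec_down 0) /dense_f ifF; last by lia.
  by rewrite scale1r (_ : _ + 2 = w0 + 1.*2%:Z) ?cyc_wvec_up //; lia.
- rewrite (_ : _ + 2 = w0 - k.*2%:Z); last by lia.
  rewrite !cyc_wvec_down iterS.
  have [_ ->] := kappa_vec_iterE K0 k gen_kappa_vec.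
  by rewrite /dense_f ifT; [congr (kappa K l _ *: _); lia | lia].
rewrite (_ : _ + 2 = w0 + k.+2.*2%:Z); last by lia.
by rewrite !cyc_wvec_up /dense_f ifF ?scale1r //; lia.
Qed.

Lemma cyc_wvec_H n : cyc_wvec n \act H = n%:~R *: cyc_wvec n.
Proof.
case: (weightP n) => [on|k ->|k ->].
- by rewrite !cyc_wvec_odd ?linear0 ?scaler0.
- by rewrite cyc_wvec_down; have [] := kappa_vec_iterE K0 k gen_kappa_vec.
- by rewrite cyc_wvec_up; have [] := kappa_vec_iterF K0 k.+1 gen_kappa_vec.
Qed.

Section Coordinates.
Hypothesis gen_ind : forall P : Q -> Prop,
  P gen -> (forall c u v, P u -> P v -> P (c *: u + v)) ->
  (forall x u, P u -> P (u \act x)) -> forall u, P u.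
Variable Phi : hom Q (dense K0 l a).
Hypothesis Phi_gen : Phi gen = delta K0 l a w0.

Lemma Phi_wvec n :
  Phi (cyc_wvec n) = if odd `|n - l| then 0 else delta K0 l a n.
Proof.
case: (weightP n) => [on|k ->|k ->].
- by rewrite cyc_wvec_odd // on linear0.
- rewrite cyc_wvec_down ifF; last by rewrite /wgen; lia.
  elim: k => [|k IHk]; first by rewrite subr0 -Phi_gen.
  rewrite iterS (hom_act Phi E) IHk delta_E /dense_e ifT; last by lia.
  by rewrite scale1r; congr delta; lia.
- rewrite cyc_wvec_up ifF; last by rewrite /wgen; lia.
  elim: k.+1 => [|j IHj]; first by rewrite addr0 -Phi_gen.
  rewrite iterS (hom_act Phi F) IHj delta_F /dense_f ifF; last by lia.
  by rewrite scale1r; congr delta; lia.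
Qed.

Lemma PhiP c u v n : Phi (c *: u + v) n = c * Phi u n + Phi v n.
Proof. by rewrite (hom_linear Phi). Qed.

(** The expansion is claimed over every larger list so that two vectors can be expanded over a
    common list, and so that lists can be shifted under [E] and [F]. In particular [Phi] is
    injective. *)
Lemma Phi_expand u : exists s : seq int,
  (forall n, n \notin s -> Phi u n = 0) /\
  (forall t : seq int, uniq t -> {subset s <= t} ->
     u = \sum_(n <- t) Phi u n *: cyc_wvec n).
Proof.
elim/gen_ind: u => [|c u v [s [s0 sE]] [t [t0 tE]]|x u [s [s0 sE]]].
- exists [:: w0]; rewrite Phi_gen; split=> [n|t ut w0t].
    by rewrite inE /delta eq_sym => /negbTE ->.
  rewrite (bigD1_seq w0) ?w0t ?inE //= big1 => [|n nw0].
    by rewrite /delta eqxx scale1r addr0 -[w0]subr0 (cyc_wvec_down 0).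
  by rewrite /delta eq_sym (negbTE nw0) scale0r.
- exists (s ++ t); split=> [n|r ur sub].
    rewrite mem_cat negb_or => /andP[ns nt].
    by rewrite PhiP s0 // t0 // mulr0 addr0.
  have /(sE r ur) us : {subset s <= r}.
    by move=> n ns; rewrite sub // mem_cat ns.
  have /(tE r ur) vt : {subset t <= r}.
    by move=> n nt; rewrite sub // mem_cat nt orbT.
  rewrite [in LHS]us [in LHS]vt.
  rewrite scaler_sumr -big_split /=; apply: eq_bigr => n _.
  by rewrite PhiP scalerDl scalerA.
- case: x.
  + exists [seq n - 2 | n <- s]; split=> [n nt|t ut sub].
      rewrite (hom_act Phi) /= s0 ?mulr0 //.
      by apply: contra nt => h; apply/mapP; exists (n + 2); rewrite ?addrK.
    rewrite [in LHS](sE [seq n + 2 | n <- t]).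
    * rewrite big_map linear_sum /=; apply: eq_bigr => n _.
      rewrite actZ cyc_wvec_E addrK (hom_act Phi) /= scalerA.
      by congr (_ *: _); rewrite mulrC.
    * by rewrite map_inj_uniq //; exact: addIr.
    * move=> n /(map_f (fun n => n - 2))/sub; move=> h.
      by apply/mapP; exists (n - 2); rewrite ?subrK.
  + exists [seq n + 2 | n <- s]; split=> [n nt|t ut sub].
      rewrite (hom_act Phi) /= s0 ?mulr0 //.
      by apply: contra nt => h; apply/mapP; exists (n - 2); rewrite ?subrK.
    rewrite [in LHS](sE [seq n - 2 | n <- t]).
    * rewrite big_map linear_sum /=; apply: eq_bigr => n _.
      rewrite actZ cyc_wvec_F subrK (hom_act Phi) /= scalerA.
      by congr (_ *: _); rewrite mulrC.
    * by rewrite map_inj_uniq //; exact: addIr.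
    * move=> n /(map_f (fun n => n + 2))/sub; move=> h.
      by apply/mapP; exists (n + 2); rewrite ?addrK.
  + exists s; split=> [n ns|t ut sub].
      by rewrite (hom_act Phi) /= s0 ?mulr0.
    rewrite [in LHS](sE t) // linear_sum /=; apply: eq_bigr => n _.
    rewrite actZ cyc_wvec_H (hom_act Phi) /= scalerA.
    by congr (_ *: _); rewrite mulrC.
Qed.

Definition cyclic_ladder : ladder Q.
Proof.
apply: (@Ladder K Q (fun n => ~~ odd `|n - l|) cyc_wvec Phi de df).
- exact: PhiP.
- move=> m n; rewrite Phi_wvec; case: ifP => om; rewrite /delta.
    by case: eqP => // <-; rewrite om.
  by case: eqP => // <-; rewrite om.
- move=> u n /negPn on; have [s [s0 sE]] := Phi_expand u.
  rewrite (sE (undup s)) ?undup_uniq // => [|m]; last by rewrite mem_undup.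
  elim: (undup s) => [|m t IHt]; first by rewrite big_nil linear0.
  rewrite big_cons PhiP IHt addr0 Phi_wvec.
  case: ifP => om; first by rewrite mulr0.
  rewrite /delta; case: eqP => [mn|_]; last by rewrite mulr0.
  by rewrite mn on in om.
- by move=> u; have [s [s0 _]] := Phi_expand u; exists s.
- move=> u h; have [s [_ sE]] := Phi_expand u.
  rewrite (sE (undup s)) ?undup_uniq // => [|m]; last by rewrite mem_undup.
  by rewrite big1 // => n _; rewrite h scale0r.
- by move=> u n; rewrite (hom_act Phi H).
- by move=> u n; rewrite (hom_act Phi E).
- by move=> u n; rewrite (hom_act Phi F).
Defined.

End Coordinates.
End CyclicLadder.

Section RmodLadder.
Variables (K : fieldType) (K0 : injective (fun n : int => n%:~R : K)).
Variables (l a : int).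
Local Notation Q := (Rmod l (a%:~R : K)).
Local Notation gen := (Rgen l (a%:~R : K)).

Lemma gen_kappa_vec : kappa_vec l (wgen l a) gen.
Proof.
by split; rewrite ?Rgen_H ?Rgen_EF ?wgen_intr ?(kappa_wgen K0).
Qed.

(** The proof is opaque, so later arguments about R(l,a) see its ladder only through these
    equations. *)
Lemma Rmod_ladder_sig : {L : ladder Q | [/\ forall n, dom L n = ~~ odd `|n - l|,
  forall n, ecoef L n = dense_e K l a n, forall n, fcoef L n = dense_f K l a n
  & wvec L (wgen l a) = gen]}.
Proof.
have [Phi Phi_gen] := cid (Rmod_dense_hom K0 l a).
exists (cyclic_ladder gen_kappa_vec (@Rgen_ind K l a%:~R) Phi_gen); split=> //.
by have := cyc_wvec_down l a gen 0; rewrite subr0.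
Qed.

End RmodLadder.

(** * Maps out of R(l,a) and the isomorphism criterion *)

Section Criteria.
Variables (K : fieldType) (K0 : injective (fun n : int => n%:~R : K)).

Local Notation V mu := (verma_ladder K0 mu).
Local Notation Q l a := (Rmod l (a%:~R : K)).
Local Notation M mu := (verma (mu%:~R : K)).

Definition Rmod_ladder l a : ladder (Q l a) := sval (Rmod_ladder_sig K0 l a).

Local Notation RL := Rmod_ladder.

Lemma dom_Rmod_ladder l a n : dom (RL l a) n = ~~ odd `|n - l|.
Proof. by rewrite /Rmod_ladder; case: Rmod_ladder_sig => L [] /=. Qed.

Lemma ecoef_Rmod_ladder l a n : ecoef (RL l a) n = dense_e K l a n.
Proof. by rewrite /Rmod_ladder; case: Rmod_ladder_sig => L [] /=. Qed.

Lemma fcoef_Rmod_ladder l a n : fcoef (RL l a) n = dense_f K l a n.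
Proof. by rewrite /Rmod_ladder; case: Rmod_ladder_sig => L [] /=. Qed.

Lemma wvec_Rmod_ladder l a : wvec (RL l a) (wgen l a) = Rgen l (a%:~R : K).
Proof. by rewrite /Rmod_ladder; case: Rmod_ladder_sig => L [] /=. Qed.

Lemma dom_wgen l a : dom (RL l a) (wgen l a).
Proof. by rewrite dom_Rmod_ladder /wgen; lia. Qed.

Lemma casimir_Rmod_ladder l a : casimir l (RL l a).
Proof. by move=> n _; rewrite ecoef_Rmod_ladder fcoef_Rmod_ladder dense_ef. Qed.

Section Onto.
Variables (l a : int) (N : rmod K) (B : ladder N).
Local Notation w0 := (wgen l a).
Hypotheses (cas : casimir l B)
  (par : forall n, dom B n -> ~~ odd `|n - l|) (Bw0 : dom B w0)
  (down : forall n, n <= w0 -> dom B (n - 2) -> dom B n)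
  (up : forall n, w0 <= n -> dom B (n + 2) -> dom B n)
  (link_e : forall n, n \in [:: l; 2 - l] -> n <= w0 ->
     dom B n -> dom B (n - 2) -> ecoef B n != 0)
  (link_f : forall n, n \in [:: l; 2 - l] -> w0 <= n - 2 ->
     dom B n -> dom B (n - 2) -> fcoef B (n - 2) != 0).

(** The generator goes to the weight vector of weight w0. Nonvanishing spreads from there, downwards
    by [E] and upwards by [F], along a domain without gaps; off the links both coefficients are
    nonzero because their product [kappa] is. *)
Lemma Rmod_onto : exists h : hom (Q l a) N,
  forall n, dom B n -> hsupp (RL l a) B h n.
Proof.
have [||h hgen] := @Rmod_hom K l a%:~R N (wvec B w0).
- by rewrite -wgen_intr wvec_H.
- rewrite -(kappa_wgen K0) -(cas Bw0) wvec_E // actZ.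
  (* If w0 is the lowest weight of N, both sides vanish. *)
  have [B2|B2] := boolP (dom B (w0 - 2)).
    by rewrite wvec_F // scalerA subrK.
  by rewrite (ecoef_bound Bw0 B2) mul0r !scale0r.
exists h => n Bn.
have hw0 : hsupp (RL l a) B h w0.
  by rewrite /hsupp /hdiag wvec_Rmod_ladder hgen coord_wvec eqxx Bw0 oner_eq0.
have ef m : dom B m -> m \notin [:: l; 2 - l] ->
    (ecoef B m != 0) /\ (fcoef B (m - 2) != 0).
  move=> Bm; rewrite !inE -(kappa_eq0 K0) -(cas Bm) mulf_eq0 negb_or.
  by move=> /andP.
have A0 m : ~~ odd `|m - l| -> dom (RL l a) m by rewrite dom_Rmod_ladder.
case: (weightP l a n) => [on|k nE|k nE].
- by have := par Bn; rewrite on.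
- elim: k n Bn nE => [|k IHk] n Bn nE; first by rewrite nE subr0.
  have Bn2 : dom B (n + 2) by apply: down; [lia | rewrite addrK].
  have e0 : ecoef B (n + 2) != 0.
    have [i|/(ef _ Bn2)[]//] := boolP (n + 2 \in [:: l; 2 - l]).
    by apply: link_e => //; rewrite ?addrK //; lia.
  have := hdiag_E K0 B h (A0 _ (par Bn2)).
  rewrite addrK ecoef_Rmod_ladder /dense_e ifT ?mulr1; last by lia.
  move=> hE; rewrite /hsupp hE mulf_neq0 //; apply: IHk => //; lia.
- elim: k.+1 n Bn nE => [|j IHj] n Bn nE; first by rewrite nE addr0.
  have Bn2 : dom B (n - 2) by apply: up; [lia | rewrite subrK].
  have f0 : fcoef B (n - 2) != 0.
    have [i|/(ef _ Bn)[]//] := boolP (n \in [:: l; 2 - l]).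
    by apply: link_f => //; lia.
  have := hdiag_F K0 B h (A0 _ (par Bn2)).
  rewrite subrK fcoef_Rmod_ladder /dense_f ifF ?mulr1; last by lia.
  move=> hF; rewrite /hsupp hF mulf_neq0 //; apply: IHj => //; lia.
Qed.

End Onto.

(** When N has every weight of the right parity, a map nonzero on all its weights is also nonzero on
    all those of R(l,a). *)
Lemma Rmod_iso l a (N : rmod K) (B : ladder N) : casimir l B ->
  (forall n, dom B n = ~~ odd `|n - l|) ->
  (forall n, n \in [:: l; 2 - l] -> n <= wgen l a -> ecoef B n != 0) ->
  (forall n, n \in [:: l; 2 - l] -> wgen l a < n -> fcoef B (n - 2) != 0) ->
  isomorphic (Q l a) N.
Proof.
move=> cas par he hf; have [||||||h hh] := @Rmod_onto l a N B cas.
- by move=> n; rewrite par.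
- by rewrite par -(dom_Rmod_ladder l a) dom_wgen.
- by move=> n _; rewrite !par; lia.
- by move=> n _; rewrite !par; lia.
- by move=> n i nw _ _; apply: he.
- by move=> n i nw _ _; apply: hf => //; lia.
exists h; apply/(hom_bijP K0 (RL l a) B); split=> // n.
by rewrite dom_Rmod_ladder -par; exact: hh.
Qed.

Lemma kappa_sym l n : kappa K (2 - l) n = kappa K l n.
Proof.
have n4 : 4%:R != 0 :> K by apply: (@intr_neq0 K K0 4).
by rewrite /kappa !(rmorphD, rmorphN) /=; field.
Qed.

Lemma dense_e_neq0 l a m n : m \in [:: l; 2 - l] -> n \in [:: l; 2 - l] ->
  (dense_e K m a n != 0) = (n <= wgen m a).
Proof.
move=> mi ni; rewrite /dense_e; case: ifP => // _; first by rewrite oner_eq0.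
apply/negbTE; rewrite negbK (kappa_eq0 K0).
by move: mi ni; rewrite !inE; lia.
Qed.

Lemma dense_f_neq0 l a m n : m \in [:: l; 2 - l] -> n \in [:: l; 2 - l] ->
  (dense_f K m a (n - 2) != 0) = (wgen m a < n).
Proof.
move=> mi ni; rewrite /dense_f subrK ltNge; case: ifP => // _; last first.
  by rewrite oner_eq0.
apply/negbTE; rewrite negbK (kappa_eq0 K0).
by move: mi ni; rewrite !inE; lia.
Qed.

(** An isomorphism preserves [kappa], hence its set of roots, and the vanishing of [E] at each root,
    which tells on which side of it the generator lies. Conversely these data are what [Rmod_iso]
    asks for. *)
Lemma Rmod_isoP l m a b : isomorphic (Q l a) (Q m b) <->
  [/\ m \in [:: l; 2 - l], (l <= wgen l a) = (l <= wgen m b)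
    & (2 - l <= wgen l a) = (2 - l <= wgen m b)].
Proof.
have l1 : l \in [:: l; 2 - l] by rewrite inE eqxx.
have l2 : 2 - l \in [:: l; 2 - l] by rewrite !inE eqxx orbT.
split=> [[h bij_h]|[mi h1 h2]]; last first.
  apply: (@Rmod_iso _ _ _ (RL m b)).
  - move=> n Bn; rewrite (casimir_Rmod_ladder Bn).
    by move: mi; rewrite !inE => /orP[]/eqP-> //; apply: kappa_sym.
  - by move=> n; rewrite dom_Rmod_ladder; move: mi; rewrite !inE; lia.
  - move=> n ni nw; rewrite ecoef_Rmod_ladder (dense_e_neq0 b mi ni).
    by move: ni nw; rewrite !inE => /orP[]/eqP->; rewrite ?h1 ?h2.
  - move=> n ni nw; rewrite fcoef_Rmod_ladder (dense_f_neq0 b mi ni).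
    by move: ni nw; rewrite !inE !ltNge => /orP[]/eqP->; rewrite ?h1 ?h2.
have [hA hB] := (hom_bijP K0 (RL l a) (RL m b) h).1 bij_h.
have dd := isomorphic_ladder K0 (RL l a) (RL m b) bij_h.
have hE n : dom (RL l a) n -> (ecoef (RL l a) n != 0) = (ecoef (RL m b) n != 0).
  move=> An; have An2 : dom (RL l a) (n - 2).
    by move: An; rewrite !dom_Rmod_ladder; lia.
  have /(congr1 (fun x => x != 0)) := hdiag_E K0 (RL m b) h An.
  have := hA _ An2; have := hA _ An; rewrite /hsupp !mulf_eq0 !negb_or => -> ->.
  by rewrite andbT.
have kE n : dom (RL l a) n -> kappa K l n = kappa K m n.
  move=> An; have Bn : dom (RL m b) n by rewrite -dd.
  have An2 : dom (RL l a) (n - 2) by move: An; rewrite !dom_Rmod_ladder; lia.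
  rewrite -(casimir_Rmod_ladder An) -(casimir_Rmod_ladder Bn).
  have eE := hdiag_E K0 (RL m b) h An.
  have := hdiag_F K0 (RL m b) h An2; rewrite subrK => fE.
  apply: (mulfI (hA _ An)); apply: (mulfI (hA _ An2)).
  (* Pairs each coefficient with the diagonal entry at the end of its arrow, the form in which [eE]
     and [fE] apply. *)
  have -> (x y z t : K) : x * (y * (z * t)) = (x * z) * (y * t) by ring.
  by rewrite eE fE; ring.
have lA : dom (RL l a) l by rewrite dom_Rmod_ladder subrr.
have l2A : dom (RL l a) (2 - l) by rewrite dom_Rmod_ladder; lia.
have mi : m \in [:: l; 2 - l].
  have /eqP kll : kappa K l l == 0 by rewrite (kappa_eq0 K0) eqxx.
  have := kE l lA; rewrite kll.
  by move=> /esym/eqP; rewrite (kappa_eq0 K0) !inE; lia.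
split=> //.
  have := hE l lA; rewrite !ecoef_Rmod_ladder (dense_e_neq0 _ mi l1).
  by rewrite (dense_e_neq0 _ l1 l1).
have := hE _ l2A; rewrite !ecoef_Rmod_ladder (dense_e_neq0 _ mi l2).
by rewrite (dense_e_neq0 _ l1 l2).
Qed.

End Criteria.

(** * Verma submodules and quotients of R(l,a), and its twist and dual *)

Section Sequences.
Variables (K : fieldType) (K0 : injective (fun n : int => n%:~R : K)).

Local Notation V mu := (verma_ladder K0 mu).
Local Notation Q l a := (Rmod l (a%:~R : K)).
Local Notation M mu := (verma (mu%:~R : K)).
Local Notation RL := (Rmod_ladder K0).

Lemma twist_dom_verma mu n :
  dom (twist_ladder (V mu)) n = (n <= mu) && ~~ odd `|n + mu|.
Proof.
by rewrite [LHS](dom_verma K0 mu (- n)); lia.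
Qed.

Section Sub.
Variables (mu : int) (N : rmod K) (B : ladder N).
Hypotheses (Bmu : dom B (- mu)) (Emu : ecoef B (- mu) = 0)
  (Fmu : forall n, dom (V mu) n -> fcoef B n != 0).

(** The vector of weight -mu is killed by [E], so it is the image of the generator of M(mu); nonzero
    [F] coefficients then keep every image nonzero. *)
Lemma verma_into : exists i : hom (M mu) N,
  forall n, dom (V mu) n -> hsupp (V mu) B i n.
Proof.
have [||i i1] := @verma_hom K mu%:~R N (wvec B (- mu)).
- by rewrite wvec_E // Emu scale0r.
- by rewrite wvec_H rmorphN.
exists i => n Vn; move: (Vn); rewrite /=.
case en: verma_idx => [k|//] _; move/verma_idxE: en => nE.
elim: k n Vn nE => [|k IHk] n Vn nE.
  have wn : wvec (V mu) n = 1.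
    by move/verma_idxE: nE; rewrite /= => ->.
  have -> : n = - mu by rewrite nE add0r.
  have wmu : wvec (V mu) (- mu) = 1 by rewrite -wn nE add0r.
  by rewrite /hsupp /hdiag wmu i1 coord_wvec eqxx Bmu oner_eq0.
have Vn2 : dom (V mu) (n - 2) by move: Vn; rewrite !dom_verma; lia.
have := hdiag_F K0 B i Vn2; rewrite subrK mulr1 => iE.
rewrite /hsupp iE mulf_neq0 ?Fmu //; apply: IHk => //; lia.
Qed.

End Sub.

(** Beyond the generator every [F] arrow is 1, and at the link -mu the [E] arrow is [kappa] = 0: the
    weights from -mu upwards span a Verma module. *)
Lemma verma_into_Rmod l a mu : - mu \in [:: l; 2 - l] -> wgen l a < - mu ->
  exists i : hom (M mu) (Q l a),
    forall n, dom (V mu) n -> hsupp (V mu) (RL l a) i n.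
Proof.
move=> mi wmu; apply: verma_into.
- by rewrite dom_Rmod_ladder; move: mi; rewrite !inE; lia.
- apply/eqP; rewrite ecoef_Rmod_ladder -[_ == 0]negbK (dense_e_neq0 K0 _ _ mi).
    by rewrite -ltNge.
  by rewrite inE eqxx.
move=> n; rewrite dom_verma fcoef_Rmod_ladder /dense_f => /andP[nmu _].
by rewrite ifF ?oner_eq0 //; lia.
Qed.

(** A map from M(mu) to the twist of R(l,a) is a map from the twist of M(mu) to R(l,a), so the
    untwisted construction is reused. *)
Lemma twist_verma_into_Rmod l a mu :
  mu + 2 \in [:: l; 2 - l] -> mu + 2 <= wgen l a ->
  exists i : hom (twist (M mu)) (Q l a),
    forall n, dom (twist_ladder (V mu)) n ->
    hsupp (twist_ladder (V mu)) (RL l a) i n.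
Proof.
move=> mi wmu; have [|||g hg] := @verma_into mu _ (twist_ladder (RL l a)).
- by rewrite /= dom_Rmod_ladder; move: mi; rewrite !inE; lia.
- apply/eqP; rewrite /= opprK fcoef_Rmod_ladder -[_ == 0]negbK.
  rewrite -[mu in dense_f _ _ _ mu](addrK 2).
  by rewrite (dense_f_neq0 K0 (l := l)) // ?inE ?eqxx // -leNgt.
- move=> n; rewrite dom_verma /= ecoef_Rmod_ladder /dense_e => /andP[nmu _].
  by rewrite ifT ?oner_eq0 //; lia.
exists (untwist_hom g) => n /hg; rewrite /hsupp /hdiag.
by rewrite -[coord (twist_ladder _) _ _]/(coord (RL l a) _ (- - n)) opprK.
Qed.

Lemma casimir_verma_ladder l mu : - mu \in [:: l; 2 - l] -> casimir l (V mu).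
Proof. by move=> mi; apply: casimir_verma; move: mi; rewrite !inE; lia. Qed.

Section Quotients.
Variables (l a mu : int).
Hypothesis mi : - mu \in [:: l; 2 - l].
Local Notation w0 := (wgen l a).

Let links n : n \in [:: l; 2 - l] -> n = - mu \/ n = mu + 2.
Proof. by move: mi; rewrite !inE; lia. Qed.

Let par n : odd `|n - l| = odd `|n + mu|.
Proof. by move: mi; rewrite !inE; lia. Qed.

Let parw : ~~ odd `|w0 + mu|.
Proof. by rewrite -par /wgen; lia. Qed.

Lemma Rmod_onto_verma : - mu <= w0 -> (w0 < mu + 2) || (mu + 2 <= - mu) ->
  exists p : hom (Q l a) (M mu),
    forall n, dom (V mu) n -> hsupp (RL l a) (V mu) p n.
Proof.
move=> w1 w2; apply: (@Rmod_onto K K0 l a _ (V mu)).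
- exact: casimir_verma_ladder.
- by move=> n; rewrite dom_verma par => /andP[].
- by rewrite dom_verma w1 parw.
- by move=> n nw; rewrite !dom_verma; lia.
- by move=> n nw; rewrite !dom_verma; lia.
- by move=> n /links ln nw; rewrite !dom_verma; lia.
- by move=> n _ _ _ _; rewrite /= oner_eq0.
Qed.

Lemma Rmod_onto_twist_verma : w0 <= mu -> (- mu <= w0) || (mu < - mu) ->
  exists p : hom (Q l a) (twist (M mu)),
    forall n, dom (twist_ladder (V mu)) n ->
    hsupp (RL l a) (twist_ladder (V mu)) p n.
Proof.
move=> w1 w2; apply: (@Rmod_onto K K0 l a _ (twist_ladder (V mu))).
- exact/casimir_twist/casimir_verma_ladder.
- by move=> n; rewrite twist_dom_verma par => /andP[].
- by rewrite twist_dom_verma w1 parw.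
- by move=> n nw; rewrite !twist_dom_verma; lia.
- by move=> n nw; rewrite !twist_dom_verma; lia.
- by move=> n _ _ _ _; rewrite /= oner_eq0.
- by move=> n /links ln nw; rewrite !twist_dom_verma; lia.
Qed.

Lemma Rmod_onto_dual_verma : - mu <= w0 -> (mu < w0) || (mu < - mu) ->
  exists p : hom (Q l a) (dual (M mu)), forall n, dom (V mu) n ->
    hsupp (RL l a) (dual_ladder K0 (V mu)) p n.
Proof.
move=> w1 w2; apply: (@Rmod_onto K K0 l a _ (dual_ladder K0 (V mu))).
- exact/casimir_dual/casimir_verma_ladder.
- by move=> n; rewrite [dom _ _](dom_verma K0) par => /andP[].
- by rewrite [dom _ _](dom_verma K0) w1 parw.
- by move=> n nw; rewrite ![dom (dual_ladder _ _) _](dom_verma K0); lia.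
- by move=> n nw; rewrite ![dom (dual_ladder _ _) _](dom_verma K0); lia.
- move=> n _ _ _ n2.
  by rewrite -[ecoef _ _]/(if dom (V mu) (n - 2) then 1 else 0) n2 oner_eq0.
- move=> n /links ln nw.
  by rewrite ![dom (dual_ladder _ _) _](dom_verma K0); lia.
Qed.

Lemma Rmod_onto_dual_twist_verma : w0 <= mu -> (w0 < - mu) || (mu < - mu) ->
  exists p : hom (Q l a) (dual (twist (M mu))), forall n,
    dom (twist_ladder (V mu)) n ->
    hsupp (RL l a) (dual_ladder K0 (twist_ladder (V mu))) p n.
Proof.
move=> w1 w2.
apply: (@Rmod_onto K K0 l a _ (dual_ladder K0 (twist_ladder (V mu)))).
- exact/casimir_dual/casimir_twist/casimir_verma_ladder.
- by move=> n; rewrite [dom _ _]twist_dom_verma par => /andP[].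
- by rewrite [dom _ _]twist_dom_verma w1 parw.
- by move=> n nw; rewrite ![dom (dual_ladder _ _) _]twist_dom_verma; lia.
- by move=> n nw; rewrite ![dom (dual_ladder _ _) _]twist_dom_verma; lia.
- move=> n /links ln nw.
  by rewrite ![dom (dual_ladder _ _) _]twist_dom_verma; lia.
- move=> n _ _ n1 _; rewrite /= subrK.
  rewrite -[X in if X then _ else _]/(dom (twist_ladder (V mu)) n).
  by rewrite [dom _ _]n1 oner_eq0.
Qed.

End Quotients.

Lemma Rmod_short_exact l a (A C : rmod K) (LA : ladder A) (LC : ladder C) :
  (exists i : hom A (Q l a), forall n, dom LA n -> hsupp LA (RL l a) i n) ->
  (exists p : hom (Q l a) C, forall n, dom LC n -> hsupp (RL l a) LC p n) ->
  (forall n, ~~ odd `|n - l| -> dom LC n = ~~ dom LA n) ->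
  has_short_exact A (Q l a) C.
Proof.
move=> [i hi] [p hp] compl; exists i, p; apply/(short_exactP K0 LA (RL l a) LC).
split=> // n; rewrite dom_Rmod_ladder => /compl e.
have -> : hsupp (RL l a) LC p n = dom LC n.
  by apply/idP/idP => [/hsupp_dom[]|/hp].
have -> : hsupp LA (RL l a) i n = dom LA n.
  by apply/idP/idP => [/hsupp_dom[]|/hi].
by [].
Qed.

(** The twist swaps [E] with [F] and sends the link n to 2 - n, so the two conditions are both
    negated and crossed. For the type = exactly one of them holds, hence it is fixed. *)
Lemma Rmod_twist_iso l a b :
  (l <= wgen l b) = ~~ (2 - l <= wgen l a) ->
  (2 - l <= wgen l b) = ~~ (l <= wgen l a) ->
  isomorphic (twist (Q l a)) (Q l b).
Proof.
move=> h1 h2; apply: isomorphic_sym.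
have l1 : l \in [:: l; 2 - l] by rewrite inE eqxx.
apply: (@Rmod_iso K K0 l b _ (twist_ladder (RL l a))).
- exact/casimir_twist/casimir_Rmod_ladder.
- by move=> n; rewrite /= dom_Rmod_ladder; lia.
- move=> n ni; rewrite /= fcoef_Rmod_ladder.
  rewrite (_ : - n = 2 - n - 2); last by lia.
  rewrite (dense_f_neq0 K0 (l := l)) //; move: ni; rewrite !inE; lia.
- move=> n ni; rewrite /= ecoef_Rmod_ladder.
  rewrite (_ : - (n - 2) = 2 - n); last by lia.
  rewrite (dense_e_neq0 K0 (l := l)) //; move: ni; rewrite !inE; lia.
Qed.

(** The dual swaps [E] with [F] but keeps each weight, so each condition is negated in place. *)
Lemma Rmod_dual_iso l a b :
  (l <= wgen l b) = ~~ (l <= wgen l a) ->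
  (2 - l <= wgen l b) = ~~ (2 - l <= wgen l a) ->
  isomorphic (dual (Q l a)) (Q l b).
Proof.
move=> h1 h2; apply: isomorphic_sym.
have l1 : l \in [:: l; 2 - l] by rewrite inE eqxx.
apply: (@Rmod_iso K K0 l b _ (dual_ladder K0 (RL l a))).
- exact/casimir_dual/casimir_Rmod_ladder.
- by move=> n; rewrite /= dom_Rmod_ladder.
- move=> n ni nw; rewrite /= dom_Rmod_ladder ifT.
    rewrite fcoef_Rmod_ladder (dense_f_neq0 K0 (l := l)) // ltNge.
    by move: ni nw; rewrite !inE => /orP[]/eqP->; rewrite ?h1 ?h2.
  by move: ni; rewrite !inE; lia.
- move=> n ni nw; rewrite /= subrK dom_Rmod_ladder ifT.
    rewrite ecoef_Rmod_ladder (dense_e_neq0 K0 (l := l)) //.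
    by move: ni nw; rewrite !inE => /orP[]/eqP->; rewrite ltNge ?h1 ?h2 negbK.
  by move: ni; rewrite !inE; lia.
Qed.

Section Exchanges.
Variables (A B C A' B' C' : rmod K).
Variables (LA : ladder A) (LB : ladder B) (LC : ladder C).
Variables (LA' : ladder A') (LB' : ladder B') (LC' : ladder C').

Lemma twist_exchanges_ladder : (forall n, dom LA' n = dom LA (- n)) ->
  isomorphic (twist B) B' -> isomorphic (twist B') B ->
  twist_exchanges A B C A' B' C'.
Proof.
move=> dA iB iB' i p i' p' ex ex'; split.
  apply: (@seq_isomorphic_of_ladder K K0 _ _ _ _ _ _ (twist_ladder LA)
    (twist_ladder LB) (twist_ladder LC) LA' LB' LC' _ _ _ _
    (twist_short_exact ex) ex').
    by move=> n; rewrite dA.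
  exact: iB.
apply: (@seq_isomorphic_of_ladder K K0 _ _ _ _ _ _ (twist_ladder LA')
    (twist_ladder LB') (twist_ladder LC') LA LB LC _ _ _ _
    (twist_short_exact ex') ex).
  by move=> n; rewrite [LHS]dA opprK.
exact: iB'.
Qed.

Lemma dual_exchanges_ladder : (forall n, dom LA' n = dom LC n) ->
  (forall n, dom LC' n = dom LA n) ->
  isomorphic (dual B) B' -> isomorphic (dual B') B ->
  dual_exchanges A B C A' B' C'.
Proof.
move=> dA dC iB iB' i p i' p' ex ex'; split.
  apply: (@seq_isomorphic_of_ladder K K0 _ _ _ _ _ _ (dual_ladder K0 LC)
    (dual_ladder K0 LB) (dual_ladder K0 LA) LA' LB' LC' _ _ _ _
    (dual_short_exact K0 LA LB LC ex) ex').
    by move=> n; rewrite dA.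
  exact: iB.
apply: (@seq_isomorphic_of_ladder K K0 _ _ _ _ _ _ (dual_ladder K0 LC')
    (dual_ladder K0 LB') (dual_ladder K0 LA') LA LB LC _ _ _ _
    (dual_short_exact K0 LA' LB' LC' ex') ex).
  by move=> n; rewrite [LHS]dC.
exact: iB'.
Qed.

End Exchanges.
End Sequences.

(** * The four families of exact sequences *)

Section VermaSequences.
Variables (K : fieldType) (K0 : injective (fun n : int => n%:~R : K)).

Local Notation V mu := (verma_ladder K0 mu).
Local Notation Q l a := (Rmod l (a%:~R : K)).
Local Notation M mu := (verma (mu%:~R : K)).

Variables (l a mu nu : int).
Hypotheses (mi : - mu \in [:: l; 2 - l]) (nuE : nu = - mu - 2).
Local Notation w0 := (wgen l a).

Let ni : nu + 2 \in [:: l; 2 - l].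
Proof. by rewrite nuE subrK. Qed.

Let ni' : - nu \in [:: l; 2 - l].
Proof. by move: mi; rewrite nuE !inE; lia. Qed.

Let par n : ~~ odd `|n - l| -> ~~ odd `|n + mu|.
Proof. by move: mi; rewrite !inE; lia. Qed.

(** With nu = -mu - 2, the weights up to nu and those from -mu on are complementary in the parity
    class of l. When M(nu) itself is the submodule, the cut lies between mu and mu + 2 instead. *)
Lemma seq_twist_dual : - mu <= w0 -> (mu < w0) || (mu < - mu) ->
  has_short_exact (twist (M nu)) (Q l a) (dual (M mu)).
Proof.
move=> w1 w2; apply: (@Rmod_short_exact K K0 l a _ _ (twist_ladder (V nu))
  (dual_ladder K0 (V mu))).
- by apply: twist_verma_into_Rmod; rewrite // nuE subrK.
- exact: Rmod_onto_dual_verma.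
- move=> n /par; rewrite [dom (dual_ladder _ _) _](dom_verma K0).
  by rewrite twist_dom_verma nuE; lia.
Qed.

Lemma seq_twist_verma : - mu <= w0 -> (w0 < mu + 2) || (mu + 2 <= - mu) ->
  has_short_exact (twist (M nu)) (Q l a) (M mu).
Proof.
move=> w1 w2.
apply: (@Rmod_short_exact K K0 l a _ _ (twist_ladder (V nu)) (V mu)).
- by apply: twist_verma_into_Rmod; rewrite // nuE subrK.
- exact: Rmod_onto_verma.
- by move=> n /par; rewrite dom_verma twist_dom_verma nuE; lia.
Qed.

Lemma seq_verma_dual : w0 <= mu -> (w0 < - mu) || (mu < - mu) ->
  has_short_exact (M nu) (Q l a) (dual (twist (M mu))).
Proof.
move=> w1 w2; apply: (@Rmod_short_exact K K0 l a _ _ (V nu)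
  (dual_ladder K0 (twist_ladder (V mu)))).
- by apply: verma_into_Rmod => //; rewrite nuE; lia.
- exact: Rmod_onto_dual_twist_verma.
- move=> n /par; rewrite [dom (dual_ladder _ _) _]twist_dom_verma.
  by rewrite dom_verma nuE; lia.
Qed.

Lemma seq_verma_twist : w0 <= mu -> (- mu <= w0) || (mu < - mu) ->
  has_short_exact (M nu) (Q l a) (twist (M mu)).
Proof.
move=> w1 w2.
apply: (@Rmod_short_exact K K0 l a _ _ (V nu) (twist_ladder (V mu))).
- by apply: verma_into_Rmod => //; rewrite nuE; lia.
- exact: Rmod_onto_twist_verma.
- by move=> n /par; rewrite dom_verma twist_dom_verma nuE; lia.
Qed.

End VermaSequences.

(** * Classification by ranges and types *)

Section Classification.
Variables (K : fieldType) (K0 : injective (fun n : int => n%:~R : K)).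
Local Notation Q l a := (Rmod l (a%:~R : K)).

(** The conditions l <= w0 and 2 - l <= w0 translate to a <= -l and a <= -1; for l = 1 they
    coincide, which leaves two classes. *)
Lemma Rmod_iso_ranges l a b : isomorphic (Q l a) (Q l b) <->
  (a <= - l) = (b <= - l) /\ (a <= - 1) = (b <= - 1).
Proof.
rewrite (Rmod_isoP K0) !inE eqxx /wgen.
by split=> [[_ h1 h2]|[h1 h2]]; split=> //; lia.
Qed.

Lemma exact_classes_ge2 l : 2 <= l -> exact_classes K l
  [:: (fun a => a <= - l); (fun a => 0 <= a); (fun a => 1 - l <= a <= - 1)].
Proof.
move=> l2; split=> [[|[|[|//]]] _ /=|a|].
- by exists (- l).
- by exists 0.
- by exists (- 1); lia.
- have [a1|a1] := boolP (a <= - l); first by exists 0%N.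
  have [a2|a2] := boolP (0 <= a); first by exists 1%N.
  by exists 2%N => //=; lia.
move=> [|[|[|//]]] [|[|[|//]]] a b _ _ /= ha hb; rewrite Rmod_iso_ranges;
  by split=> [[]|//]; lia.
Qed.

Lemma exact_classes_le0 l : l <= 0 -> exact_classes K l
  [:: (fun a => a <= - 1); (fun a => 1 - l <= a); (fun a => 0 <= a <= - l)].
Proof.
move=> l0; split=> [[|[|[|//]]] _ /=|a|].
- by exists (- 1).
- by exists (1 - l).
- by exists 0; lia.
- have [a1|a1] := boolP (a <= - 1); first by exists 0%N.
  have [a2|a2] := boolP (1 - l <= a); first by exists 1%N.
  by exists 2%N => //=; lia.
move=> [|[|[|//]]] [|[|[|//]]] a b _ _ /= ha hb; rewrite Rmod_iso_ranges;
  by split=> [[]|//]; lia.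
Qed.

Lemma exact_classes_1 : exact_classes K 1
  [:: (fun a => a <= - 1); (fun a => 0 <= a)].
Proof.
split=> [[|[|//]] _ /=|a|].
- by exists (- 1).
- by exists 0.
- have [a1|a1] := boolP (a <= - 1); first by exists 0%N.
  by exists 1%N => //=; lia.
move=> [|[|//]] [|[|//]] a b _ _ /= ha hb; rewrite Rmod_iso_ranges;
  by split=> [[]|//]; lia.
Qed.

(** A form uniform in l: the weight of the generator is at or above both links. Type > puts it below
    both, type = between them. *)
Lemma lt_typeE l a :
  lt_type l a = (a <= - 1) && (a <= - l).
Proof. by rewrite /lt_type; case: lerP => l2; lia. Qed.

Lemma gt_typeE l a : gt_type l a = (0 <= a) && (1 - l <= a).
Proof. by rewrite /gt_type; case: lerP => l0; lia. Qed.

Lemma eq_typeE l a :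
  eq_type l a = (1 - l <= a <= - 1) || (0 <= a <= - l).
Proof. by rewrite /eq_type; case: lerP => l2; lia. Qed.

(** The links of l and of 2 - l are the same, so equal types mean generators on the same side of
    each link. *)
Lemma Rmod_iso_types l m a b : l <> m ->
  isomorphic (Q l a) (Q m b) <->
  m = - l + 2 /\ [|| lt_type l a && lt_type m b, gt_type l a && gt_type m b
                    | eq_type l a && eq_type m b].
Proof.
move=> lm; rewrite (Rmod_isoP K0) !inE /wgen !lt_typeE !gt_typeE !eq_typeE.
split=> [[mi h1 h2]|[mi h]].
  have mE : m = - l + 2 by lia.
  by split=> //; lia.
by split; lia.
Qed.

Lemma twist_iso_lt_gt l a b : lt_type l a -> gt_type l b ->
  isomorphic (twist (Q l a)) (Q l b).
Proof.
rewrite lt_typeE gt_typeE => ha hb; apply: (Rmod_twist_iso K0);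
  rewrite /wgen; lia.
Qed.

Lemma twist_iso_gt_lt l a b : lt_type l a -> gt_type l b ->
  isomorphic (twist (Q l b)) (Q l a).
Proof.
rewrite lt_typeE gt_typeE => ha hb; apply: (Rmod_twist_iso K0);
  rewrite /wgen; lia.
Qed.

Lemma twist_iso_eq l a b : eq_type l a -> eq_type l b ->
  isomorphic (twist (Q l a)) (Q l b).
Proof.
rewrite !eq_typeE => ha hb; apply: (Rmod_twist_iso K0);
  rewrite /wgen; lia.
Qed.

Lemma dual_iso_lt_gt l a b : lt_type l a -> gt_type l b ->
  isomorphic (dual (Q l a)) (Q l b).
Proof.
rewrite lt_typeE gt_typeE => ha hb; apply: (Rmod_dual_iso K0);
  rewrite /wgen; lia.
Qed.

Lemma dual_iso_gt_lt l a b : lt_type l a -> gt_type l b ->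
  isomorphic (dual (Q l b)) (Q l a).
Proof.
rewrite lt_typeE gt_typeE => ha hb; apply: (Rmod_dual_iso K0);
  rewrite /wgen; lia.
Qed.

End Classification.

Theorem lemma5p2 (R : realType) :
  let M (m : int) : rmod R[i] := verma m%:~R in
  let Q (l a : int) : rmod R[i] := Rmod l a%:~R in
  (* (1) *)
  (forall l : int, 2 <= l ->
    [/\ exact_classes R[i] l [:: (fun a => a <= - l); (fun a => 0 <= a);
                                 (fun a => 1 - l <= a <= - 1)],
      (forall a : int, a <= - l ->
         (* (a) *) has_short_exact (twist (M (- l))) (Q l a) (dual (M (l - 2)))
         /\
         (* (b) *) has_short_exact (twist (M (l - 2))) (Q l a) (M (- l))),
      (forall a : int, 0 <= a ->
         (* (c) *) has_short_exact (M (- l)) (Q l a) (dual (twist (M (l - 2))))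
         /\
         (* (d) *) has_short_exact (M (l - 2)) (Q l a) (twist (M (- l)))) &
      (forall a : int, 1 - l <= a <= - 1 ->
         (* (e) *) has_short_exact (M (- l)) (Q l a) (twist (M (l - 2)))
         /\
         (* (f) *) has_short_exact (twist (M (- l))) (Q l a) (M (l - 2)))])
  /\
  (* (2) *)
  (forall l : int, l <= 0 ->
    [/\ exact_classes R[i] l [:: (fun a => a <= - 1); (fun a => 1 - l <= a);
                                 (fun a => 0 <= a <= - l)],
      (forall a : int, a <= - 1 ->
         has_short_exact (twist (M (l - 2))) (Q l a) (dual (M (- l)))
         /\
         has_short_exact (twist (M (- l))) (Q l a) (M (l - 2))),
      (forall a : int, 1 - l <= a ->
         has_short_exact (M (l - 2)) (Q l a) (dual (twist (M (- l))))
         /\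
         has_short_exact (M (- l)) (Q l a) (twist (M (l - 2)))) &
      (forall a : int, 0 <= a <= - l ->
         has_short_exact (M (l - 2)) (Q l a) (twist (M (- l)))
         /\
         has_short_exact (twist (M (l - 2))) (Q l a) (M (- l)))])
  /\
  (* (3) *)
  [/\ exact_classes R[i] 1 [:: (fun a => a <= - 1); (fun a => 0 <= a)],
      (forall a : int, a <= - 1 ->
         (* (g) *) has_short_exact (twist (M (- 1))) (Q 1 a) (M (- 1))) &
      (forall a : int, 0 <= a ->
         (* (h) *) has_short_exact (M (- 1)) (Q 1 a) (twist (M (- 1))))]
  /\
  (* (4) *)
  (forall l m a b : int, l <> m ->
    (isomorphic (Q l a) (Q m b) <->
       m = - l + 2 /\
       [|| lt_type l a && lt_type m b,
           gt_type l a && gt_type m b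
         | eq_type l a && eq_type m b]))
  /\
  (* (5) *)
  [/\ (forall l a b : int, lt_type l a -> gt_type l b ->
         isomorphic (twist (Q l a)) (dual (Q l a)) /\
         isomorphic (dual (Q l a)) (Q l b)),
      (forall l a b : int, l <> 1 -> eq_type l a -> eq_type l b ->
         isomorphic (twist (Q l a)) (Q l b)),
      (forall l a b : int, 2 <= l -> lt_type l a -> gt_type l b ->
         [/\ (* (a), (c) *)
             twist_exchanges
               (twist (M (- l))) (Q l a) (dual (M (l - 2)))
               (M (- l)) (Q l b) (dual (twist (M (l - 2)))),
             (* (b), (d) *)
             twist_exchanges
               (twist (M (l - 2))) (Q l a) (M (- l))
               (M (l - 2)) (Q l b) (twist (M (- l))),
             (* (a), (d) *)
             dual_exchanges
               (twist (M (- l))) (Q l a) (dual (M (l - 2)))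
               (M (l - 2)) (Q l b) (twist (M (- l))) &
             (* (b), (c) *)
             dual_exchanges
               (twist (M (l - 2))) (Q l a) (M (- l))
               (M (- l)) (Q l b) (dual (twist (M (l - 2))))]),
      (forall l a b : int, 2 <= l -> eq_type l a -> eq_type l b ->
         (* (e), (f) *)
         twist_exchanges
           (M (- l)) (Q l a) (twist (M (l - 2)))
           (twist (M (- l))) (Q l b) (M (l - 2))) &
      (forall a b : int, lt_type 1 a -> gt_type 1 b ->
         (* (g), (h) *)
         twist_exchanges
           (twist (M (- 1))) (Q 1 a) (M (- 1))
           (M (- 1)) (Q 1 b) (twist (M (- 1)))
         /\
         dual_exchanges
           (twist (M (- 1))) (Q 1 a) (M (- 1))
           (M (- 1)) (Q 1 b) (twist (M (- 1))))].
Proof.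
have K0 : injective (fun n : int => n%:~R : R[i]) by apply: intr_inj.
move=> M Q; rewrite {}/M {}/Q.
split; [|split; [|split; [|split]]].
- move=> l l2; split.
  + exact: exact_classes_ge2.
  (* Here and below the sequences arise with {mu, nu} = {-l, l - 2}, in either order. *)
  + move=> a al; split.
      by apply: (seq_twist_dual K0); rewrite ?inE /wgen; lia.
    by apply: (seq_twist_verma K0); rewrite ?inE /wgen; lia.
  + move=> a al; split.
      by apply: (seq_verma_dual K0); rewrite ?inE /wgen; lia.
    by apply: (seq_verma_twist K0); rewrite ?inE /wgen; lia.
  + move=> a al; split.
      by apply: (seq_verma_twist K0); rewrite ?inE /wgen; lia.
    by apply: (seq_twist_verma K0); rewrite ?inE /wgen; lia.
- move=> l l0; split.
  + exact: exact_classes_le0.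
  + move=> a al; split.
      by apply: (seq_twist_dual K0); rewrite ?inE /wgen; lia.
    by apply: (seq_twist_verma K0); rewrite ?inE /wgen; lia.
  + move=> a al; split.
      by apply: (seq_verma_dual K0); rewrite ?inE /wgen; lia.
    by apply: (seq_verma_twist K0); rewrite ?inE /wgen; lia.
  + move=> a al; split.
      by apply: (seq_verma_twist K0); rewrite ?inE /wgen; lia.
    by apply: (seq_twist_verma K0); rewrite ?inE /wgen; lia.
- split.
  + exact: exact_classes_1.
  + by move=> a al; apply: (seq_twist_verma K0); rewrite ?inE /wgen; lia.
  + by move=> a al; apply: (seq_verma_twist K0); rewrite ?inE /wgen; lia.
- by move=> l m a b lm; apply: Rmod_iso_types.
pose V mu := verma_ladder K0 mu; pose tV mu := twist_ladder (V mu).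
pose L l a := Rmod_ladder K0 l a.
have tVK mu n : dom (V mu) n = dom (tV mu) (- n).
  by rewrite -[n in LHS]opprK.
split.
- move=> l a b la lb.
  have iso_d : isomorphic (dual (Rmod l (a%:~R : R[i]))) (Rmod l b%:~R).
    exact: dual_iso_lt_gt.
  (* Twist and dual of type < are compared through type >. *)
  split=> //; apply: isomorphic_trans (isomorphic_sym iso_d).
  exact: twist_iso_lt_gt.
- by move=> l a b _; apply: twist_iso_eq.
- move=> l a b l2 la lb.
  have t1 := twist_iso_lt_gt K0 la lb; have t2 := twist_iso_gt_lt K0 la lb.
  have d1 := dual_iso_lt_gt K0 la lb; have d2 := dual_iso_gt_lt K0 la lb.
  split.
  + by apply: (twist_exchanges_ladder K0 (LA := tV (- l)) (L l a)
      (dual_ladder K0 (V (l - 2))) (LA' := V (- l)) (L l b)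
      (dual_ladder K0 (tV (l - 2)))).
  + by apply: (twist_exchanges_ladder K0 (LA := tV (l - 2)) (L l a)
      (V (- l)) (LA' := V (l - 2)) (L l b) (tV (- l))).
  + by apply: (dual_exchanges_ladder K0 (LA := tV (- l)) (L l a)
      (LC := dual_ladder K0 (V (l - 2))) (LA' := V (l - 2)) (L l b)
      (LC' := tV (- l))).
  + by apply: (dual_exchanges_ladder K0 (LA := tV (l - 2)) (L l a)
      (LC := V (- l)) (LA' := V (- l)) (L l b)
      (LC' := dual_ladder K0 (tV (l - 2)))).
- move=> l a b l2 la lb.
  by apply: (twist_exchanges_ladder K0 (LA := V (- l)) (L l a)
    (tV (l - 2)) (LA' := tV (- l)) (L l b) (V (l - 2))) => //;
    apply: twist_iso_eq.
move=> a b la lb.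
have t1 := twist_iso_lt_gt K0 la lb; have t2 := twist_iso_gt_lt K0 la lb.
have d1 := dual_iso_lt_gt K0 la lb; have d2 := dual_iso_gt_lt K0 la lb.
split.
  by apply: (twist_exchanges_ladder K0 (LA := tV (- 1)) (L 1 a)
    (V (- 1)) (LA' := V (- 1)) (L 1 b) (tV (- 1))).
by apply: (dual_exchanges_ladder K0 (LA := tV (- 1)) (L 1 a)
  (LC := V (- 1)) (LA' := V (- 1)) (L 1 b) (LC' := tV (- 1))).
Qed.
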